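(* Let $\lambda\in\mathbb Z_{\ge0}^N$, $|\lambda|=n$, $I=I_{\mu_1\cdots\mu_i\mu_{i+1}\cdots\mu_n}\in\mathcal I_\lambda$ and $1\le i\le n-1$. Then $$\widetilde W_{I_{\cdots\mu_{i+1}\mu_i\cdots}}(t,\dots,z_{i+1},z_i,\dots,\Pi)=\sum_{\mu_i',\mu_{i+1}'=1}^N\overline R\big(z_i/z_{i+1},\Pi q^{-2\sum_{j=i}^n\langle\bar\epsilon_{\mu_j},h\rangle}\big)_{\mu_i\mu_{i+1}}^{\mu_i'\mu_{i+1}'}\ \widetilde W_{I_{\cdots\mu_i'\mu_{i+1}'\cdots}}(t,\dots,z_i,z_{i+1},\dots,\Pi).$$ On the left-hand side the labels and the variables in positions $i,i+1$ are interchanged (labels $\mu_1,\dots,\mu_{i+1},\mu_i,\dots,\mu_n$, variables $z_1,\dots,z_{i+1},z_i,\dots,z_n$); on the right-hand side the labels are $\mu_1,\dots,\mu_i',\mu_{i+1}',\dots,\mu_n$ and the variables are $z_1,\dots,z_n$.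
   Context: **Theta function.** $0<|q|<1$ (branch of $\log q$ fixed), $r$ a generic positive real, $p=q^{2r}$, $[u]=q^{u^2/r-u}\Theta_p(q^{2u})$, $\Theta_p(z)=(z;p)_\infty(p/z;p)_\infty(p;p)_\infty$, $(x;p)_\infty=\prod_{n\ge0}(1-xp^n)$. **Combinatorics.** $\mathcal I_\lambda$ is the set of partitions $I=(I_1,\dots,I_N)$ of $\{1,\dots,n\}$ with $|I_l|=\lambda_l$; $I_{\mu_1\cdots\mu_n}$ denotes the partition with $I_l=\{i:\mu_i=l\}$. $\lambda^{(l)}=\lambda_1+\cdots+\lambda_l$, $I^{(l)}=I_1\cup\cdots\cup I_l=\{i^{(l)}_1<\cdots<i^{(l)}_{\lambda^{(l)}}\}$. **Variables.** $t=(t^{(l)}_a)_{1\le l\le N-1,\,1\le a\le\lambda^{(l)}}$, $t^{(l)}_a=q^{2v^{(l)}_a}$, $z_k=q^{2u_k}$; in $\widetilde W_I(t,z,\Pi)$, $v^{(N)}_k$ is the additive variable of the $k$-th entry of $z$. Generic dynamical parameters $(P+h)_{j,k}$ with $(P+h)_{j,k}+(P+h)_{k,l}=(P+h)_{j,l}$; $\Pi_{j,k}=q^{2(P+h)_{j,k}}$. $\langle\bar\epsilon_\mu,h_{j,k}\rangle=\delta_{\mu,j}-\delta_{\mu,k}$, and $\Pi q^{2\sum_m c_m\langle\bar\epsilon_{\mu_m},h\rangle}$ means $(P+h)_{j,k}$ is replaced by $(P+h)_{j,k}+\sum_mc_m\langle\bar\epsilon_{\mu_m},h_{j,k}\rangle$.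 $C_{\mu_s,l+1}(s)=\sum_{j=s+1}^n\langle\bar\epsilon_{\mu_j},h_{\mu_s,l+1}\rangle$. **Weight functions.** $W_I(t,z,\Pi)=\mathrm{Sym}_{t^{(1)}}\cdots\mathrm{Sym}_{t^{(N-1)}}U_I(t,z,\Pi)$, where $\mathrm{Sym}_{t^{(l)}}$ is the sum over all permutations of $t^{(l)}_1,\dots,t^{(l)}_{\lambda^{(l)}}$ and \begin{align*}U_I=\prod_{l=1}^{N-1}\prod_{a=1}^{\lambda^{(l)}}\Bigg(&\frac{[v^{(l+1)}_b-v^{(l)}_a+(P+h)_{\mu_s,l+1}-C_{\mu_s,l+1}(s)][1]}{[(P+h)_{\mu_s,l+1}-C_{\mu_s,l+1}(s)]}\Bigg|_{i^{(N)}_s=i^{(l+1)}_b=i^{(l)}_a}\\&\times\prod_{\substack{b=1\\ i^{(l+1)}_b>i^{(l)}_a}}^{\lambda^{(l+1)}}[v^{(l+1)}_b-v^{(l)}_a]\prod_{\substack{b=1\\ i^{(l+1)}_b<i^{(l)}_a}}^{\lambda^{(l+1)}}[v^{(l+1)}_b-v^{(l)}_a+1]\prod_{b=a+1}^{\lambda^{(l)}}\frac{[v^{(l)}_b-v^{(l)}_a+1]}{[v^{(l)}_b-v^{(l)}_a]}\Bigg)\end{align*} (in the first factor $b,s$ are the indices determined by $i^{(N)}_s=s=i^{(l+1)}_b=i^{(l)}_a$). $H_\lambda(t,z)=\prod_{l=1}^{N-1}\prod_{a=1}^{\lambda^{(l)}}\prod_{b=1}^{\lambda^{(l+1)}}[v^{(l+1)}_b-v^{(l)}_a+1]$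 and $\widetilde W_I=W_I/H_\lambda$. **Elliptic dynamical $R$-matrix.** With $z=q^{2u}$, $s=(P+h)_{j_1,j_2}$, the nonzero entries of $\overline R(z,\Pi)_{\mu_1\mu_2}^{\mu_1'\mu_2'}$ (coefficient of $E_{\mu_1,\mu_1'}\otimes E_{\mu_2,\mu_2'}$) are, for $1\le j\le N$ and $1\le j_1<j_2\le N$: $\overline R_{jj}^{jj}=1$, $\overline R_{j_1j_2}^{j_1j_2}=\frac{[s+1][s-1][u]}{[s]^2[u+1]}$, $\overline R_{j_2j_1}^{j_2j_1}=\frac{[u]}{[u+1]}$, $\overline R_{j_1j_2}^{j_2j_1}=\frac{[1][s+u]}{[s][u+1]}$, $\overline R_{j_2j_1}^{j_1j_2}=\frac{[1][s-u]}{[s][u+1]}$. *)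

(* Defs.v *)
From HB Require Import structures.
From mathcomp Require Import all_boot all_order all_algebra all_fingroup.
From mathcomp Require Import complex.
From mathcomp Require Import all_classical all_reals all_analysis.

Set Implicit Arguments.
Unset Strict Implicit.
Unset Printing Implicit Defensive.

Import Order.TTheory GRing.Theory Num.Theory.
Import numFieldNormedType.Exports.

Local Open Scope ring_scope.
Local Open Scope complex_scope.

(* Indices are 0-based: the usual label l + 1 is (l : 'I_N), position
   k + 1 is (k : 'I_n), and t^(l)_(a+1) is (v l a).  Levels l keep their
   mathematical value, so that lambda^(l) = \sum_(j < l) lam j. *)

(** * Theta function *)

Definition cexp (R : realType) (x : R[i]) : R[i] :=
  let: a +i* b := x in (expR a)%:C * (cos b +i* sin b).

Definition qpoch (R : realType) (x p : R[i]) : R[i] :=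
  lim ((fun m : nat => \prod_(0 <= k < m) (1 - x * p ^+ k) : R[i]^o) @ \oo)%classic.

Definition Theta (R : realType) (p z : R[i]) : R[i] :=
  qpoch z p * qpoch (p / z) p * qpoch p p.

(* q ^ x for the branch of log q given by logq *)
Definition qpow (R : realType) (logq x : R[i]) : R[i] := cexp (x * logq).

Definition ebr (R : realType) (logq : R[i]) (r : R) (u : R[i]) : R[i] :=
  qpow logq (u ^+ 2 / r%:C - u)
  * Theta (qpow logq (2 * r%:C)) (qpow logq (2 * u)).

(** * Words and partitions *)

Definition Iword (N n : nat) (mu : n.-tuple 'I_N) (l : 'I_N) : {set 'I_n} :=
  [set k | tnth mu k == l].

Definition calI (N n : nat) (lam : 'I_N -> nat) (I : 'I_N -> {set 'I_n}) : Prop :=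
  [/\ forall l, #|I l| = lam l,
      forall l m, l != m -> [disjoint I l & I m]
    & \bigcup_(l < N) I l = [set: 'I_n]]%SET.

Definition lamU (N : nat) (lam : 'I_N -> nat) (l : nat) : nat :=
  (\sum_(j < N | j < l) lam j)%N.

Definition Iup (N n : nat) (mu : n.-tuple 'I_N) (l : nat) : {set 'I_n} :=
  (\bigcup_(j < N | (j < l)%N) Iword mu j)%SET.

(* The position i^(l)_(a+1), as a natural number.  [enum] lists 'I_n in
   increasing order; the default n is never reached when mu is in I_lambda. *)
Definition pos (N n : nat) (mu : n.-tuple 'I_N) (l a : nat) : nat :=
  nth n [seq val k | k <- enum (Iup mu l)] a.

(* <epsbar_m, h_(j,k)> *)
Definition epsh (N : nat) (m j k : 'I_N) : int := (m == j)%:Z - (m == k)%:Z.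

(* Additive form of  Pi q^(2 \sum_m c_m <epsbar_(mu_m), h>) *)
Definition shiftP (F : fieldType) (N n : nat) (mu : n.-tuple 'I_N)
    (c : 'I_n -> int) (P : 'I_N -> 'I_N -> F) : 'I_N -> 'I_N -> F :=
  fun j k => P j k + (\sum_(m < n) c m * epsh (tnth mu m) j k)%:~R.

Definition Cshift (N n : nat) (mu : n.-tuple 'I_N) (s : 'I_n) (k : 'I_N) : int :=
  \sum_(j < n | (s < j)%N) epsh (tnth mu j) (tnth mu s) k.

(* The word s with its entries in positions i and j replaced by x and y. *)
Definition upd2 (T : Type) (n : nat) (i j : 'I_n) (x y : T) (s : n.-tuple T) :
    n.-tuple T :=
  [tuple if k == i then x else if k == j then y else tnth s k | k < n].

(** * Weight functions

    Everything is written in the additive variables v, u, (P+h)_(j,k), and [br]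
    stands for the bracket u |-> [u]. *)

Definition vars (F : fieldType) (N : nat) (lam : 'I_N -> nat) : Type :=
  forall l : nat, 'I_(lamU lam l) -> F.

(* Puts the additive variables u of z at level N; only the levels 1, .., N-1 of
   v are significant. *)
Definition with_z (F : fieldType) (N : nat) (lam : 'I_N -> nat)
    (v : vars F lam) (u : seq F) : vars F lam :=
  fun l a => if l == N then u`_a else v l a.
Arguments with_z {F N lam} v u l a.

(* U_I for I = I_mu.  The factor indexed by l : 'I_N with 0 < l is the one of
   level l in 1, .., N-1; as labels are 0-based, (P+h)_(mu_s,l+1) is
   P (tnth mu s) l.  For mu in I_lambda exactly one pair (b, s) satisfies the
   condition i^(N)_s = i^(l+1)_b = i^(l)_a. *)
Definition weightU (F : fieldType) (br : F -> F) (N n : nat) (lam : 'I_N -> nat)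
    (mu : n.-tuple 'I_N) (P : 'I_N -> 'I_N -> F) (y : vars F lam) : F :=
  \prod_(l < N | (0 < l)%N) \prod_(a < lamU lam l)
    ((\prod_(b < lamU lam l.+1) \prod_(s < n |
         [&& pos mu N s == s, pos mu l.+1 b == s & pos mu l a == s])
        (br (y l.+1 b - y l a
             + (P (tnth mu s) l - (Cshift mu s l)%:~R)) * br 1
         / br (P (tnth mu s) l - (Cshift mu s l)%:~R)))
     * \prod_(b < lamU lam l.+1 | (pos mu l a < pos mu l.+1 b)%N)
         br (y l.+1 b - y l a)
     * \prod_(b < lamU lam l.+1 | (pos mu l.+1 b < pos mu l a)%N)
         br (y l.+1 b - y l a + 1)
     * \prod_(b < lamU lam l | (a < b)%N)
         (br (y l b - y l a + 1) / br (y l b - y l a))).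

Definition Sym (F : fieldType) (N : nat) (lam : 'I_N -> nat) (l : nat)
    (f : vars F lam -> F) : vars F lam -> F :=
  fun v => \sum_(s : 'S_(lamU lam l))
    f (@dfwith nat (fun k => 'I_(lamU lam k) -> F) v l (fun a => v l (s a))).

Definition weightW (F : fieldType) (br : F -> F) (N n : nat) (lam : 'I_N -> nat)
    (mu : n.-tuple 'I_N) (v : vars F lam) (u : seq F)
    (P : 'I_N -> 'I_N -> F) : F :=
  foldr (fun l f => Sym l f) (fun w => weightU br mu P (with_z w u))
    (iota 1 N.-1) v.

Definition weightH (F : fieldType) (br : F -> F) (N : nat) (lam : 'I_N -> nat)
    (v : vars F lam) (u : seq F) : F :=
  \prod_(l < N | (0 < l)%N) \prod_(a < lamU lam l) \prod_(b < lamU lam l.+1)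
    br (with_z v u l.+1 b - with_z v u l a + 1).

Definition weightWt (F : fieldType) (br : F -> F) (N n : nat) (lam : 'I_N -> nat)
    (mu : n.-tuple 'I_N) (v : vars F lam) (u : seq F)
    (P : 'I_N -> 'I_N -> F) : F :=
  weightW br mu v u P / weightH br v u.

(** * Elliptic dynamical R-matrix

    [Rbar br u P m1 m2 m1' m2'] is the coefficient of
    E_(m1,m1') (x) E_(m2,m2') in Rbar(q^(2u), Pi). *)
Definition Rbar (F : fieldType) (br : F -> F) (N : nat) (u : F)
    (P : 'I_N -> 'I_N -> F) (m1 m2 m1' m2' : 'I_N) : F :=
  if m1 == m2 then ((m1' == m1) && (m2' == m2))%:R
  else if (m1' == m1) && (m2' == m2) then
    if (m1 < m2)%N then
      br (P m1 m2 + 1) * br (P m1 m2 - 1) * br u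
      / (br (P m1 m2) ^+ 2 * br (u + 1))
    else br u / br (u + 1)
  else if (m1' == m2) && (m2' == m1) then
    if (m1 < m2)%N then
      br 1 * br (P m1 m2 + u) / (br (P m1 m2) * br (u + 1))
    else
      br 1 * br (P m2 m1 - u) / (br (P m2 m1) * br (u + 1))
  else 0.

(* Main.v *)
Require Import Defs.
From HB Require Import structures.
From mathcomp Require Import all_boot all_order all_algebra all_fingroup.
From mathcomp Require Import complex.
From mathcomp Require Import all_classical all_reals all_analysis.
From mathcomp Require Import ring lra zify.
Import Order.TTheory GRing.Theory Num.Theory.
Import numFieldNormedType.Exports.
Local Open Scope ring_scope.
Local Open Scope complex_scope.

Set Implicit Arguments.
Unset Strict Implicit.
Unset Printing Implicit Defensive.

(** The identity rests on one analytic fact and one induction.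

    The analytic fact is that the bracket satisfies
    [x + y][x - y] = A(x) B(y) - B(x) A(y) for two functions A and B
    ([ebr_rank_two]).  By the Jacobi triple product ([theta_series]) the bracket
    is an alternating sum of Gaussians over the lattice r Z, so [x + y][x - y] is
    a sum over Z^2; the rotation (m, n) |-> (m + n, m - n) diagonalizes the
    quadratic form, and its image, the pairs of integers of equal parity, is the
    union of two products of lattices in Z.  The products [x + y][x - y] are thus 2 x 2
    minors, and the Pluecker relation among them is the three-term relation
    [fay], from which every identity between brackets used here is deduced.  Where
    such a deduction would divide by a bracket that may vanish, it also uses that
    the zeros of the bracket form a group ([ebr_zeroD]).

    The induction is over the levels.  A weight function can be summed from level
    1 upwards: [partialW] at one level is obtained from the level below by a
    sum over permutations weighted by [layer], the factor of U_I that involves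
    two consecutive levels.  Compare a word w with the word [swapw w] in which the
    labels a < b at the neighbouring positions i and i1 are interchanged.
    - Up to level b at most one of the two positions is present at a level, and
      interchanging labels amounts to interchanging positions
      ([partialW_below]).
    - One level higher both positions appear for the first time, and
      the R-matrix relation between the two words is a three-term relation
      ([exch_first]).
    - On each further level both positions are present.  A layer is then a
      kernel in the variables at i and i1 times a factor that is symmetric in
      them ([layer_kern]), and pairing each permutation with its composite with
      the transposition of these two variables reduces the step to the statement
      that a two-variable kernel transports the R-matrix relation ([kern_exch]).
    At the top level the variables at i and i1 are the two spectral parameters,
    and the transported relation is the theorem.  For a = b the same induction
    propagates the symmetry in the two variables instead ([partialW_same]). *)

(** * The three-term relation of the bracket *)

(** The products br (x + y) * br (x - y) are the 2 x 2 minors of the vectors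
    (A x, B x): among the forms of the three-term relation this one is both closest
    to the theta series and handiest for deriving the others. *)
Definition rank_two (F : fieldType) (br : F -> F) : Prop :=
  exists A B : F -> F,
    forall x y, br (x + y) * br (x - y) = A x * B y - B x * A y.

Section Combination.
Variable R : comPzRingType.
Implicit Types (a b c x y : R).

(** The lemmas [eq_comb] reduce an equation that is a linear combination of known
    ones to a polynomial identity, the coefficients being given. *)
Lemma eq_comb1 c a b x y : a = b -> x - y = c * (a - b) -> x = y.
Proof. by move=> -> e; apply: subr0_eq; rewrite e subrr mulr0. Qed.

Lemma eq_comb2 c1 c2 a1 b1 a2 b2 x y : a1 = b1 -> a2 = b2 ->
  x - y = c1 * (a1 - b1) + c2 * (a2 - b2) -> x = y.
Proof.
by move=> -> -> e; apply: subr0_eq; rewrite e !subrr !mulr0 addr0.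
Qed.

Lemma eq_comb3 c1 c2 c3 a1 b1 a2 b2 a3 b3 x y : a1 = b1 -> a2 = b2 -> a3 = b3 ->
  x - y = c1 * (a1 - b1) + c2 * (a2 - b2) + c3 * (a3 - b3) -> x = y.
Proof.
by move=> -> -> -> e; apply: subr0_eq; rewrite e !subrr !mulr0 !addr0.
Qed.

Lemma eq_comb4 c1 c2 c3 c4 a1 b1 a2 b2 a3 b3 a4 b4 x y :
  a1 = b1 -> a2 = b2 -> a3 = b3 -> a4 = b4 ->
  x - y = c1 * (a1 - b1) + c2 * (a2 - b2) + c3 * (a3 - b3) + c4 * (a4 - b4) ->
  x = y.
Proof.
by move=> -> -> -> -> e; apply: subr0_eq; rewrite e !subrr !mulr0 !addr0.
Qed.

End Combination.
Arguments eq_comb4 {R} c1 c2 c3 c4 {a1 b1 a2 b2 a3 b3 a4 b4 x y}.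
Arguments eq_comb1 {R} c {a b x y}.
Arguments eq_comb2 {R} c1 c2 {a1 b1 a2 b2 x y}.
Arguments eq_comb3 {R} c1 c2 c3 {a1 b1 a2 b2 a3 b3 x y}.

Section Bracket.
Variables (F : numFieldType) (br : F -> F).
Hypothesis br2 : rank_two br.

Lemma brN x : br (- x) = - br x.
Proof.
case: br2 => A [B AB].
have anti (w z : F) : br w * br z = - (br w * br (- z)).
  have := AB ((w + z) / 2) ((w - z) / 2).
  have := AB ((w - z) / 2) ((w + z) / 2).
  rewrite (_ : (w - z) / 2 + (w + z) / 2 = w); last by field; rewrite ?pnatr_eq0.
  rewrite (_ : (w - z) / 2 - (w + z) / 2 = - z); last by field; rewrite ?pnatr_eq0.
  rewrite (_ : (w + z) / 2 + (w - z) / 2 = w); last by field; rewrite ?pnatr_eq0.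
  rewrite (_ : (w + z) / 2 - (w - z) / 2 = z); last by field; rewrite ?pnatr_eq0.
  move=> -> ->; ring.
have [bx0 | bx0] := eqVneq (br x) 0.
  have /eqP := anti (- x) (- x); rewrite opprK bx0 mulr0 oppr0.
  by rewrite mulf_eq0 orbb => /eqP.
have := anti x x; rewrite -mulrN => /(mulfI bx0) ->.
by rewrite opprK.
Qed.

(** Pluecker's relation.  With h half of the common sum a + a' = b + b' = c + c',
    the product br a * br a' is the minor of the vectors at h and a - h, and
    br d * br d' is the minor of those at b - h and c - h.  The arguments are
    variables subject to equations, so that a relation can be stated with the
    brackets in the form in which they occur. *)
Lemma fay a a' b b' c c' d d' e e' g g' :
    a + a' = b + b' -> a + a' = c + c' ->
    b - c' = d -> b - c = d' -> c - a' = e -> c - a = e' ->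
    a - b' = g -> a - b = g' ->
  br a * br a' * (br d * br d') + br b * br b' * (br e * br e')
  + br c * br c' * (br g * br g') = 0.
Proof.
move=> eb ec <- <- <- <- <- <-; case: br2 => A [B AB].
have two0 : (2 : F) != 0 by rewrite pnatr_eq0.
pose h := (a + a') / 2.
have prod z z' : a + a' = z + z' -> br z * br z' = A h * B (z - h) - B h * A (z - h).
  move=> ez; rewrite -AB; congr (br _ * br _); first by ring.
  have -> : z' = a + a' - z by rewrite ez; ring.
  by rewrite /h; field.
have pair z z' w w' : a + a' = z + z' -> a + a' = w + w' ->
    br (w - z') * br (w - z) = A (w - h) * B (z - h) - B (w - h) * A (z - h).
  move=> ez ew; rewrite -AB; congr (br _ * br _); last by ring.
  have -> : z' = a + a' - z by rewrite ez; ring.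
  by rewrite /h; field.
rewrite (prod a a') // (prod b b') // (prod c c') //.
rewrite (pair c c' b b') // (pair a a' c c') // (pair b b' a a') //.
ring.
Qed.

End Bracket.

(** * Exchange relations in two variables *)

Section TwoVariables.
Variables (F : numFieldType) (br : F -> F).
Hypothesis br2 : rank_two br.

Let N := brN br2.
Let fayb := fay br2.

(** Unitarity of the R-matrix: it recovers one exchange relation from the other,
    up to a factor br D. *)
Lemma unit_rel s D :
  br s ^+ 2 * (br (D + 1) * br (1 - D))
  = br 1 ^+ 2 * (br (s + D) * br (s - D)) - br (s + 1) * br (s - 1) * br D ^+ 2.
Proof.
have H : br s * br s * (br (D + 1) * br (1 - D))
         + br (s + 1) * br (s - 1) * (br D * br D)
         + br (s + D) * br (s - D) * (br 1 * br (- 1)) = 0.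
  by apply: fayb; ring.
apply: subr0_eq; rewrite -[RHS]H N; ring.
Qed.

Section Four.
Variables (x y x' y' s al be D d : F).
Hypotheses (al_eq : al = be + s) (D_eq : D = x' - y') (d_eq : d = x - y).

(* The two arguments of each T have the same sum, and so have those of each Q:
   any three of the products T, and any three of the products Q, are linearly
   dependent.  The digits in relQ134, relT123, .. name the products involved. *)
Let T1 := br (x' - x + be) * br (y' - y + al).
Let T2 := br (x' - y + be) * br (y' - x + al).
Let T3 := br (y' - x + be) * br (x' - y + al).
Let T5 := br (y' - y + be) * br (x' - x + al).
Let Q1 := br (y' - y) * br (x' - x + 1).
Let Q2 := br (x' - x) * br (y' - y + 1).
Let Q3 := br (x' - y) * br (y' - x + 1).
Let Q4 := br (y' - x) * br (x' - y + 1).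

Lemma relQ134 : Q1 * (br (- 1) * br (D + d)) + Q3 * (br (- (D + 1)) * br (- d))
  + Q4 * (br (d - 1) * br (- D)) = 0.
Proof. by apply: fayb; rewrite ?D_eq ?d_eq; ring. Qed.

Lemma relQ124 : Q1 * (br (- (d + 1)) * br D) + Q2 * (br (- (D + 1)) * br (- d))
  + Q4 * (br (- 1) * br (d - D)) = 0.
Proof. by apply: fayb; rewrite ?D_eq ?d_eq; ring. Qed.

Lemma relT123 : T1 * (br (- s) * br (D + d)) + T2 * (br (- (s + d)) * br (- D))
  + T3 * (br (- (s - D)) * br (- d)) = 0.
Proof. by apply: fayb; rewrite ?al_eq ?D_eq ?d_eq; ring. Qed.

Lemma relT135 : T1 * (br (- (s + D)) * br (- d)) + T3 * (br (- s) * br (d - D))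
  + T5 * (br (- (s + d)) * br D) = 0.
Proof. by apply: fayb; rewrite ?al_eq ?D_eq ?d_eq; ring. Qed.

Lemma relT235 : T2 * (br (- (s + D)) * br (- d)) + T3 * (br (d - s) * br (- D))
  + T5 * (br (- s) * br (D + d)) = 0.
Proof. by apply: fayb; rewrite ?al_eq ?D_eq ?d_eq; ring. Qed.

(** The coefficient of g2 in the first exchange relation of [kern_exch]. *)
Lemma ident1 :
  br (D + 1) * br s * T1 * Q3 * br d
  = br D * (T1 * Q4 * br (d - 1) * br s + T2 * Q1 * br 1 * br (s + d))
    + br 1 * br (s - D) * T3 * Q1 * br d.
Proof.
have R1 := relT123; have R2 := relQ134; rewrite !N in R1 R2.
apply: (eq_comb2 (- br 1 * Q1) (T1 * br s) R1 R2); ring.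
Qed.

(** Where br D vanishes unitarity gives no information, but the relations lose a
    term each and become proportionalities, which match in pairs. *)
Lemma ident2_zero :
  br D = 0 -> br d != 0 -> br (D + d) != 0 -> br (d - D) != 0 ->
  br s * br (D + 1) * (T3 * Q2 * br (d - 1) * br s + T5 * Q3 * br 1 * br (s + d))
  = br (s + 1) * br (s - 1) * br D * T3 * Q1 * br d
    + br 1 * br (s + D) * (T1 * Q4 * br (d - 1) * br s + T2 * Q1 * br 1 * br (s + d)).
Proof.
move=> D0 d0 Dd0 dD0.
have R1 := relQ134; have R2 := relQ124; have R3 := relT135; have R4 := relT235.
rewrite !N D0 in R1 R2 R3 R4.
have a : br s * br (D + 1) * T3 * Q2 = br 1 * br (s + D) * T1 * Q4.
  apply: (mulfI d0); apply: (mulfI dD0).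
  apply: (eq_comb2 (T3 * br s * br (d - D)) (- Q4 * br 1 * br (d - D)) R2 R3); ring.
have b : br s * br (D + 1) * T5 * Q3 = br 1 * br (s + D) * T2 * Q1.
  apply: (mulfI d0); apply: (mulfI Dd0).
  apply: (eq_comb2 (T5 * br s * br (D + d)) (- Q1 * br 1 * br (D + d)) R1 R4); ring.
rewrite D0; apply: (eq_comb2 (br (d - 1) * br s) (br 1 * br (s + d)) a b); ring.
Qed.

(** Here T1, .., T5 are Q2, Q3, Q4, Q1 translated by be.  Pluecker's relation turns
    each of the two differences into a product of the same three brackets with
    br (d + 1) or br (d - 1). *)
Lemma ident_sym :
  s = 1 -> T3 * Q2 * br (d - 1) + T5 * Q3 * br (d + 1)
           = T1 * Q4 * br (d - 1) + T2 * Q1 * br (d + 1).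
Proof.
move=> s1; pose c' := x' - x + (y' - y + 1) + be.
have R1 : br (x' - x) * br (y' - y + 1) * (br (- (y' - x + be)) * br (x' - y + al))
  + br (x' - y + 1) * br (y' - x) * (br (- (y' - y + al)) * br (- (x' - x + be)))
  + br (- be) * br c' * (br D * br (- (d + 1))) = 0.
  by apply: fayb; rewrite /c' ?al_eq ?s1 ?D_eq ?d_eq; ring.
have R2 : br (x' - y) * br (y' - x + 1) * (br (- (y' - y + be)) * br (x' - x + al))
  + br (x' - x + 1) * br (y' - y) * (br (- (y' - x + al)) * br (- (x' - y + be)))
  + br (- be) * br c' * (br D * br (d - 1)) = 0.
  by apply: fayb; rewrite /c' ?al_eq ?s1 ?D_eq ?d_eq; ring.
rewrite !N in R1 R2.
apply: (eq_comb2 (- br (d - 1)) (- br (d + 1)) R1 R2).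
rewrite /T1 /T2 /T3 /T5 /Q1 /Q2 /Q3 /Q4; ring.
Qed.

End Four.

(** The coefficient of g2 in the second exchange relation of [kern_exch].  For br D
    nonzero it follows from [ident1], applied to (x', y') and to
    (y', x'), and unitarity. *)
Lemma ident2 x y x' y' s al be D d :
  al = be + s -> D = x' - y' -> d = x - y -> br d != 0 ->
  (br D = 0 -> br (D + d) != 0 /\ br (d - D) != 0) ->
  br s * br (D + 1)
    * (br (y' - x + be) * br (x' - y + al) * (br (x' - x) * br (y' - y + 1))
         * br (d - 1) * br s
       + br (y' - y + be) * br (x' - x + al) * (br (x' - y) * br (y' - x + 1))
         * br 1 * br (s + d))
  = br (s + 1) * br (s - 1) * br D * (br (y' - x + be) * br (x' - y + al))
      * (br (y' - y) * br (x' - x + 1)) * br d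
    + br 1 * br (s + D)
      * (br (x' - x + be) * br (y' - y + al) * (br (y' - x) * br (x' - y + 1))
           * br (d - 1) * br s
         + br (x' - y + be) * br (y' - x + al) * (br (y' - y) * br (x' - x + 1))
           * br 1 * br (s + d)).
Proof.
move=> als eD ed d0 Dz.
have [D0 | D0] := eqVneq (br D) 0.
  by have [? ?] := Dz D0; apply: ident2_zero.
have I1 := ident1 als eD ed.
have ND : - D = y' - x' by rewrite eD opprB.
have I2 := ident1 als ND ed.
have U := unit_rel s D.
have e1 : - D + 1 = 1 - D by ring.
rewrite e1 opprK N in I2.
apply: (mulfI D0).
apply: (eq_comb3 (br s * br (D + 1)) (br 1 * br (s + D))
  (- (br (y' - x + be) * br (x' - y + al) * (br (y' - y) * br (x' - x + 1)) * br d)) I2 I1 U).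
ring.
Qed.

(** The part of U_I between two consecutive levels that involves only the positions
    i and i + 1, when both are present on both levels: x and y are the variables
    of the lower level at i and i + 1, x' and y' those of the upper level, A and B
    the dynamical parameters of the two positions. *)
Definition kern (A B x' y' x y : F) : F :=
  br (x' - x + A) * br 1 / br A * (br (y' - y + B) * br 1 / br B)
  * (br (y' - x) * br (x' - y + 1)) * (br (y - x + 1) / br (y - x)).

(** The two exchange relations given by the R-matrix with dynamical parameter s and
    spectral parameter D, cleared of denominators.  The indices ab and ba refer to
    the order of the labels a < b at the two positions, and the primes to the
    interchange of the two variables. *)
Definition exch (s D gab gba gab' gba' : F) : Prop :=
  br (D + 1) * br s * gab' = br D * br s * gba + br 1 * br (s - D) * gab /\
  br s ^+ 2 * br (D + 1) * gba'
  = br (s + 1) * br (s - 1) * br D * gab + br 1 * br s * br (s + D) * gba.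

Lemma exch_base s w x y :
  br s != 0 -> br (s + 1) != 0 ->
  exch s (x - y)
    (br (x - w + (s + 1)) * br 1 / br (s + 1) * br (y - w))
    (br (x - w + 1) * (br (y - w + s) * br 1 / br s))
    (br (y - w + (s + 1)) * br 1 / br (s + 1) * br (x - w))
    (br (y - w + 1) * (br (x - w + s) * br 1 / br s)).
Proof.
move=> s0 s1.
have R1 : br (y - w + (s + 1)) * br (x - w) * (br s * br (- (x - y + 1)))
  + br (y - w + s) * br (x - w + 1) * (br (s + 1) * br (x - y))
  + br (x - w + (s + 1)) * br (y - w) * (br (s - (x - y)) * br 1) = 0.
  by apply: fayb; ring.
have R2 : br (x - w + s) * br (y - w + 1) * (br s * br (x - y + 1))
  + br (x - w + (s + 1)) * br (y - w) * (br (s - 1) * br (- (x - y)))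
  + br (y - w + s) * br (x - w + 1) * (br (s + (x - y)) * br (- 1)) = 0.
  by apply: fayb; ring.
rewrite !N in R1 R2; split.
  apply: (eq_comb1 (- br 1 / br (s + 1)) R1); field; exact/andP.
apply: (eq_comb1 (br 1) R2); field; exact/andP.
Qed.

(** The conclusion is linear in the unknowns once g1' and g2' are eliminated.  The
    coefficients of g1 and g2 in the two relations are [ident1], [ident2] and their
    images under (al, be, s) |-> (be, al, -s).  The hypothesis on x' - y' is
    what [ident2] requires at the zeros of the bracket. *)
Lemma kern_exch s al be x y x' y' g1 g2 g1' g2' :
  al = be + s -> br s != 0 ->
  br (x - y) != 0 ->
  (br (x' - y') = 0 -> br (x' - y' + (x - y)) != 0 /\ br (x - y - (x' - y')) != 0) ->
  exch s (x - y) g1 g2 g1' g2' ->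
  exch s (x' - y')
    (kern al be x' y' x y * g1 + kern al be x' y' y x * g1')
    (kern be al x' y' x y * g2 + kern be al x' y' y x * g2')
    (kern al be y' x' x y * g1 + kern al be y' x' y x * g1')
    (kern be al y' x' x y * g2 + kern be al y' x' y x * g2').
Proof.
move=> als s0 d0 Dz [E1 E2].
have bes : be = al + - s by rewrite als addrK.
have I1 := ident1 als erefl erefl (x := x) (y := y) (x' := x') (y' := y').
have H := ident2 als erefl erefl d0 Dz.
have I2 := ident1 bes erefl erefl (x := x) (y := y) (x' := x') (y' := y').
have H' := ident2 bes erefl erefl d0 Dz.
have e1 z : br (- s - z) = - br (s + z) by rewrite -opprD N.
have e2 z : br (- s + z) = - br (s - z) by rewrite -N; congr br; ring.
rewrite !(e1, e2) !N in I2 H'.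
have r1 : br (y - x + 1) = - br (x - y - 1) by rewrite -N; congr br; ring.
have r2 : br (y - x) = - br (x - y) by rewrite -N opprB.
rewrite /exch /kern r1 r2 invrN.
move: I1 I2 H H' E1 E2; clear r1 r2 e1 e2 bes Dz.
move: (x' - y') (x - y) d0 => D d d0.
set c := (br al)^-1; set c' := (br be)^-1; set id := (br d)^-1.
move=> I1 I2 H H' E1 E2; split; apply: (mulfI s0).
- apply: (eq_comb4
    (c * c' * br 1 ^+ 2 * id * (br (D + 1) * br s * (br (x' - x + be) * br (y' - y + al)) * (br (x' - y) * br (y' - x + 1)) - br 1 * br (s - D) * (br (y' - x + be) * br (x' - y + al)) * (br (y' - y) * br (x' - x + 1))))
    (- c * c' * br 1 ^+ 2 * id * br D * (br (x' - y + be) * br (y' - x + al)) * (br (y' - y) * br (x' - x + 1)))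
    (c * c' * br 1 ^+ 2 * id * br s * g2)
    (c * c' * br 1 ^+ 2 * id * g1) E1 E2 I1 H').
  ring.
- apply: (eq_comb4
    (- c * c' * br 1 ^+ 2 * id * br (s + 1) * br (s - 1) * br D * (br (y' - x + be) * br (x' - y + al)) * (br (y' - y) * br (x' - x + 1)))
    (c * c' * br 1 ^+ 2 * id * (br s * br (D + 1) * (br (y' - y + be) * br (x' - x + al)) * (br (x' - y) * br (y' - x + 1)) - br 1 * br (s + D) * (br (x' - y + be) * br (y' - x + al)) * (br (y' - y) * br (x' - x + 1))))
    (c * c' * br 1 ^+ 2 * id * br s * g2)
    (- c * c' * br 1 ^+ 2 * id * br (s + 1) * br (s - 1) * g1) E1 E2 H I2).
  ring.
Qed.

Lemma kern_sym be x y x' y' g :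
  kern be (be + 1) y' x' x y * g + kern be (be + 1) y' x' y x * g
  = kern be (be + 1) x' y' x y * g + kern be (be + 1) x' y' y x * g.
Proof.
have I := ident_sym (x := x) (y := y) (x' := x') (y' := y') (be := be) erefl erefl erefl erefl.
have r1 : br (y - x + 1) = - br (x - y - 1) by rewrite -N; congr br; ring.
have r2 : br (y - x) = - br (x - y) by rewrite -N opprB.
rewrite /kern r1 r2 invrN.
apply: (eq_comb1 (br 1 ^+ 2 / br be / br (be + 1) / br (x - y) * g) I).
ring.
Qed.

End TwoVariables.

(** * Words, positions and orders *)

Section Words.
Variables (N' n : nat).
Local Notation N := N'.+1.
Variables (i i1 : 'I_n).
Hypothesis i1E : (i1 : nat) = i.+1.

Let tau := tperm i i1.

Definition swapw (w : n.-tuple 'I_N) : n.-tuple 'I_N :=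
  [tuple tnth w (tperm i i1 k) | k < n].

Lemma tnth_swapw w k : tnth (swapw w) k = tnth w (tperm i i1 k).
Proof. by rewrite tnth_mktuple. Qed.

Lemma swapwK : involutive swapw.
Proof. by move=> w; apply: eq_from_tnth => k; rewrite !tnth_swapw tpermK. Qed.

Lemma neq_ii1 : i != i1.
Proof. by rewrite -val_eqE /= i1E; lia. Qed.

Lemma tau_out (k : 'I_n) : k != i -> k != i1 -> tau k = k.
Proof. by move=> ki ki1; rewrite /tau tpermD // eq_sym. Qed.

Lemma in_Iup (w : n.-tuple 'I_N) l k : (k \in Iup w l) = (tnth w k < l)%N.
Proof.
apply/bigcupP/idP => [[j jl]|kl]; first by rewrite inE => /eqP ->.
by exists (tnth w k) => //; rewrite inE.
Qed.

Lemma in_Iup_swap w l k : (tperm i i1 k \in Iup (swapw w) l) = (k \in Iup w l).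
Proof. by rewrite !in_Iup tnth_swapw tpermK. Qed.

(** The transposition of two neighbours reverses no order but their own. *)
Lemma lt_tperm (k m : 'I_n) : (k < m)%N -> ~~ ((k == i) && (m == i1)) ->
  (tau k < tau m)%N.
Proof.
rewrite /tau -!val_eqE /= => km ii.
case: tpermP => [ki|ki|/eqP/negPf ki /eqP/negPf ki1];
case: tpermP => [mi|mi|/eqP/negPf mi /eqP/negPf mi1] //=.
all: move: ii km; try move: ki ki1; try move: mi mi1; rewrite -?val_eqE ?ki ?mi /= ?i1E; try lia.
all: move=> *; lia.
Qed.

Lemma ltn_tperm (A : {pred 'I_n}) : ~~ ((i \in A) && (i1 \in A)) ->
  {in A &, forall k m : 'I_n, (tau k < tau m)%N = (k < m)%N}.
Proof.
move=> nA.
have lt : {in A &, forall k m : 'I_n, (k < m)%N -> (tau k < tau m)%N}.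
  move=> k m kA mA km; apply: lt_tperm => //; apply: contra nA.
  by case/andP => /eqP <- /eqP <-; rewrite kA.
move=> k m kA mA; have [km|mk|/val_inj ->] := ltngtP k m; last by rewrite ltnn.
  by rewrite lt.
by have := lt _ _ mA kA mk; lia.
Qed.

Lemma compare_ii1 (m : 'I_n) : m != i -> m != i1 ->
  ((i < m) = (i1 < m))%N /\ ((m < i) = (m < i1))%N.
Proof. by rewrite -!val_eqE /= i1E => *; split; lia. Qed.

(** The position i^(l)_(a+1) as an ordinal; the default i is never reached. *)
Definition place (w : n.-tuple 'I_N) (l a : nat) : 'I_n :=
  nth i (enum (Iup w l)) a.

Lemma ltn_sorted_enum (A : {set 'I_n}) :
  sorted (fun k m : 'I_n => (k < m)%N) (enum A).
Proof.
have tr : transitive (fun k m : 'I_n => (k < m)%N) by move=> ? ? ?; apply: ltn_trans.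
rewrite /enum_mem -enumT /= sorted_filter //.
have := iota_ltn_sorted 0 n; rewrite -val_enum_ord sorted_map.
by [].
Qed.

Section Level.
Variables (lam : 'I_N -> nat).

(** What membership of w in I_lambda means for the sets I^(l): level l has exactly
    as many variables as positions. *)
Definition counted (w : n.-tuple 'I_N) : Prop :=
  forall l, lamU lam l = #|Iup w l|.

Lemma counted_swapw w : counted w -> counted (swapw w).
Proof.
move=> cw l; rewrite cw -(card_imset _ (@perm_inj _ tau)).
apply: eq_card => k; apply/imsetP/idP => [[m mI ->]|kI]; first by rewrite in_Iup_swap.
by exists (tau k); rewrite ?tpermK // -in_Iup_swap tpermK.
Qed.

Section Place.
Variables (w : n.-tuple 'I_N) (cw : counted w).

Lemma size_level l : size (enum (Iup w l)) = lamU lam l.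
Proof. by rewrite -cardE cw. Qed.

Lemma pos_place l a : (a < lamU lam l)%N -> pos w l a = place w l a.
Proof. by move=> al; rewrite /pos (nth_map i) ?size_level. Qed.

Lemma place_inj l a b : (a < lamU lam l)%N -> (b < lamU lam l)%N ->
  (place w l a == place w l b) = (a == b).
Proof. by move=> al bl; rewrite nth_uniq ?size_level ?enum_uniq. Qed.

Lemma place_lt l a b : (a < lamU lam l)%N -> (b < lamU lam l)%N ->
  (place w l a < place w l b)%N = (a < b)%N.
Proof.
move=> al bl.
have lt (a' b' : nat) : (b' < lamU lam l)%N -> (a' < b')%N ->
   (place w l a' < place w l b')%N.
  move=> b'l ab; have tr : transitive (fun k m : 'I_n => (k < m)%N) by move=> ? ? ?; apply: ltn_trans.
  apply: (sorted_ltn_nth tr i (ltn_sorted_enum (Iup w l))) => //;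
    by rewrite inE size_level //; apply: ltn_trans b'l.
have [ab|ba|<-] := ltngtP a b; last by rewrite ltnn.
  exact: lt.
by have := lt _ _ al ba; lia.
Qed.

Lemma place_ex l k : k \in Iup w l -> exists2 a, (a < lamU lam l)%N & place w l a = k.
Proof.
rewrite -mem_enum => kI; exists (index k (enum (Iup w l))).
  by rewrite -size_level index_mem.
by rewrite /place nth_index.
Qed.

Lemma prod_place (R : comNzRingType) l (G : 'I_n -> R) :
  \prod_(k in Iup w l) G k = \prod_(a < lamU lam l) G (place w l a).
Proof.
by rewrite -big_enum (big_nth i) size_level big_mkord.
Qed.

Variable F : fieldType.

(** Variables of level l, indexed by a, become functions of the position.  In this
    form the levels share one index set, and exchanging the labels at i and i1 does
    not renumber the variables.  At positions outside I^(l) the value is 0. *)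
Definition emb l (y : 'I_(lamU lam l) -> F) (k : 'I_n) : F :=
  \sum_(a < lamU lam l | place w l a == k) y a.

Lemma emb_place l y (a : 'I_(lamU lam l)) : emb y (place w l a) = y a.
Proof.
by rewrite /emb (big_pred1 a) // => b; rewrite place_inj.
Qed.

Lemma emb_perm l y (t : 'S_(lamU lam l)) :
  (forall a : 'I_(lamU lam l), place w l (t a) = tau (place w l a)) ->
  emb (fun a => y (t a)) = (fun k => emb y (tau k)).
Proof.
move=> ht; apply: funext => k; rewrite /emb [RHS](reindex_inj (@perm_inj _ t)) /=.
by apply: eq_bigl => a; rewrite ht (inj_eq perm_inj).
Qed.

Lemma swap_places l : i \in Iup w l -> i1 \in Iup w l ->
  exists t : 'S_(lamU lam l),
    forall a : 'I_(lamU lam l), place w l (t a) = tau (place w l a).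
Proof.
move=> /place_ex [a al ai] /place_ex [b bl bi].
exists (tperm (Ordinal al) (Ordinal bl)) => c.
case: tpermP => [-> | -> |] /=.
- by rewrite ai bi /tau tpermL.
- by rewrite ai bi /tau tpermR.
move=> /eqP; rewrite -val_eqE /= -(place_inj (l := l)) // ai => ci.
move=> /eqP; rewrite -val_eqE /= -(place_inj (l := l)) // bi => ci1.
by rewrite /tau tpermD // eq_sym.
Qed.

End Place.

(** Both sides enumerate the same set increasingly: the transposition is increasing
    on I^(l) when it does not contain both i and i1. *)
Lemma place_swapw w l a : counted w -> ~~ ((i \in Iup w l) && (i1 \in Iup w l)) ->
  (a < lamU lam l)%N -> place (swapw w) l a = tau (place w l a).
Proof.
move=> cw nI al.
suff E : enum (Iup (swapw w) l) = [seq tau k | k <- enum (Iup w l)].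
  by rewrite /place E (nth_map i) // size_level.
apply: (@irr_sorted_eq _ (fun k m : 'I_n => (k < m)%N)).
- by move=> ? ? ?; apply: ltn_trans.
- by move=> ?; rewrite ltnn.
- exact: ltn_sorted_enum.
- rewrite sorted_map; have := ltn_sorted_enum (Iup w l).
  apply: (sub_in_sorted (P := mem (Iup w l))); last by apply/allP => k; rewrite mem_enum.
  by move=> k m kI mI; rewrite /= (ltn_tperm nI).
move=> k; rewrite mem_enum -(tpermK i i1 k) in_Iup_swap.
by rewrite (mem_map perm_inj) mem_enum.
Qed.

Lemma emb_swapw w (F : fieldType) l (y : 'I_(lamU lam l) -> F) :
  counted w -> ~~ ((i \in Iup w l) && (i1 \in Iup w l)) ->
  emb (swapw w) y = (fun k => emb w y (tau k)).
Proof.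
move=> cw nI; apply: funext => k; rewrite /emb; apply: eq_bigl => a.
by rewrite place_swapw // -(inj_eq (@perm_inj _ tau)) tpermK.
Qed.

Lemma Iup_swapw_both (w : n.-tuple 'I_N) l : i \in Iup w l -> i1 \in Iup w l ->
  Iup (swapw w) l = Iup w l.
Proof.
move=> iI i1I; apply/setP => m; rewrite -{1}(tpermK i i1 m) in_Iup_swap.
by case: tpermP => [->|->|_ _]; rewrite ?iI ?i1I.
Qed.

Lemma emb_swapw_both w (F : fieldType) l (y : 'I_(lamU lam l) -> F) :
  i \in Iup w l -> i1 \in Iup w l -> emb (swapw w) y = emb w y.
Proof.
move=> iI i1I; apply: funext => k; rewrite /emb /place.
by rewrite Iup_swapw_both.
Qed.

(** * Weight functions as iterated sums over levels *)

Section Weights.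
Variables (F : numFieldType) (br : F -> F) (P : 'I_N -> 'I_N -> F).

(** The shifted dynamical parameter (P+h)_(mu_k,l+1) - C_(mu_k,l+1)(k) of U_I. *)
Definition dyn (w : n.-tuple 'I_N) (l : nat) (k : 'I_n) : F :=
  P (tnth w k) (inord l) - (Cshift w k (inord l))%:~R.

(** The bracket of U_I attached to position k of level l and position m of level
    l + 1. *)
Definition phi (w : n.-tuple 'I_N) l (Y' Y : 'I_n -> F) (k m : 'I_n) : F :=
  if k == m then br (Y' m - Y k + dyn w l k) * br 1 / br (dyn w l k)
  else if (k < m)%N then br (Y' m - Y k) else br (Y' m - Y k + 1).

Definition rho (Y : 'I_n -> F) (k m : 'I_n) : F :=
  if (k < m)%N then br (Y m - Y k + 1) / br (Y m - Y k) else 1.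

Definition prod2 (S S' : {set 'I_n}) (G : 'I_n -> 'I_n -> F) : F :=
  \prod_(k in S) \prod_(m in S') G k m.

(** All factors of U_I that belong to level l, as a function of the variables Y' of
    level l + 1 and Y of level l. *)
Definition layer (w : n.-tuple 'I_N) l (Y' Y : 'I_n -> F) : F :=
  prod2 (Iup w l) (Iup w l.+1) (phi w l Y' Y) * prod2 (Iup w l) (Iup w l) (rho Y).

Lemma pos_top (w : n.-tuple 'I_N) s : (s < n)%N -> pos w N s = s.
Proof.
move=> sn; rewrite /pos; have -> : Iup w N = [set: 'I_n].
  by apply/setP => k; rewrite in_Iup inE ltn_ord.
rewrite enum_setT -enumT.
by rewrite [[seq _ | k <- _]]val_enum_ord nth_iota.
Qed.

Lemma prod_place2 w (cw : counted w) l l' (G : 'I_n -> 'I_n -> F) :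
  prod2 (Iup w l) (Iup w l') G
  = \prod_(a < lamU lam l) \prod_(b < lamU lam l') G (place w l a) (place w l' b).
Proof.
by rewrite /prod2 (prod_place cw); apply: eq_bigr => a _; rewrite (prod_place cw).
Qed.

Lemma weightU_layer w (cw : counted w) (y : vars F lam) :
  weightU br w P y
  = \prod_(l < N | (0 < l)%N) layer w l (emb w (y l.+1)) (emb w (y l)).
Proof.
apply: eq_bigr => l _; rewrite /layer !(prod_place2 cw) -big_split /=.
apply: eq_bigr => a _; rewrite (pos_place cw) //.
congr (_ * _); last first.
  rewrite big_mkcond; apply: eq_bigr => b _.
  by rewrite /rho !(emb_place cw) (place_lt cw).
rewrite [X in _ * X * _]big_mkcond [X in _ * _ * X]big_mkcond -!big_split /=.
apply: eq_bigr => b _; rewrite (pos_place cw) //.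
have -> : \prod_(s < n | [&& pos w N s == s, place w l.+1 b == s :> nat & place w l a == s :> nat])
     (br (y l.+1 b - y l a + (P (tnth w s) l - (Cshift w s l)%:~R)) * br 1 /
      br (P (tnth w s) l - (Cshift w s l)%:~R))
   = if place w l a == place w l.+1 b then
       br (y l.+1 b - y l a + dyn w l (place w l a)) * br 1 / br (dyn w l (place w l a))
     else 1.
  case: ifP => [/eqP ab | ab].
    rewrite (big_pred1 (place w l a)) => [|s]; first by rewrite /dyn inord_val.
    by rewrite pos_top // -ab eqxx andbb /= val_eqE eq_sym.
  apply: big_pred0 => s; apply/negP => /and3P[_ /eqP/val_inj bs /eqP/val_inj as_].
  by rewrite bs as_ eqxx in ab.
rewrite /phi !(emb_place cw) -val_eqE /=.
by case: (ltngtP (place w l a) (place w l.+1 b)) => _; rewrite ?mulr1 ?mul1r.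
Qed.

Section Symmetrization.
Variables (w : n.-tuple 'I_N) (cw : counted w).
Implicit Types (v y : vars F lam).

(** The symmetrized product of the layers 1, .., m as a function of the variables of
    level m + 1. *)
Fixpoint partialW v (m : nat) (Y : 'I_n -> F) : F :=
  if m is m'.+1 then
    \sum_(s : 'S_(lamU lam m))
      layer w m Y (emb w (fun a => v m (s a)))
      * partialW v m' (emb w (fun a => v m (s a)))
  else 1.

Definition permute_level v l (s : 'S_(lamU lam l)) : vars F lam :=
  @dfwith nat (fun k => 'I_(lamU lam k) -> F) v l (fun a => v l (s a)).

Lemma permute_same v l s a : @permute_level v l s l a = v l (s a).
Proof. by rewrite /permute_level dfwithin. Qed.

Lemma permute_other v l s k : k != l -> @permute_level v l s k = v k.
Proof. by move=> kl; rewrite /permute_level dfwithout // eq_sym. Qed.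

(** Symmetrizations of different levels commute, so the one of the highest level can
    be taken as the outermost; this is what allows the sum to be organized from the
    bottom. *)
Lemma SymC (f : vars F lam -> F) l k v :
  l != k -> Defs.Sym l (Defs.Sym k f) v = Defs.Sym k (Defs.Sym l f) v.
Proof.
move=> lk; rewrite /Defs.Sym exchange_big /=; apply: eq_bigr => s _; apply: eq_bigr => t _.
congr f; apply: functional_extensionality_dep => j.
rewrite !(dfwithout _ _ lk) (dfwithout v _ (j := l)) 1?eq_sym //.
have [<-|jl] := eqVneq l j.
  by rewrite dfwithin dfwithout 1?eq_sym // dfwithin.
have [<-|jk] := eqVneq k j.
  by rewrite dfwithin dfwithout // dfwithin.
by rewrite !dfwithout.
Qed.

Lemma eq_Sym (f g : vars F lam -> F) l : f =1 g -> Defs.Sym l f =1 Defs.Sym l g.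
Proof. by move=> fg v; apply: eq_bigr => s _. Qed.

Lemma foldr_SymC (f : vars F lam -> F) l (r : seq nat) v : l \notin r ->
  foldr (fun k g => Defs.Sym k g) (Defs.Sym l f) r v = Defs.Sym l (foldr (fun k g => Defs.Sym k g) f r) v.
Proof.
elim: r v => [|k r IH] v //=; rewrite inE negb_or => /andP[lk lr].
rewrite SymC //; apply: eq_Sym => y; exact: IH.
Qed.

Lemma partialW_permute v l s m Y : (m < l)%N ->
  partialW (@permute_level v l s) m Y = partialW v m Y.
Proof.
elim: m Y => [|m IH] Y ml //=.
by apply: eq_bigr => t _; rewrite permute_other 1?IH //; lia.
Qed.

Variable u : n.-tuple F.
Let E l y : 'I_n -> F := emb w (with_z y u l).

Lemma E_top y : E N y = tnth u.
Proof.
apply: funext => k; rewrite /E.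
have kN : k \in Iup w N by rewrite in_Iup ltn_ord.
have [a aN <-] := place_ex cw kN.
have an : (a < n)%N by rewrite (leq_trans aN) // cw -[X in (_ <= X)%N]card_ord max_card.
have aE : place w N a = a :> nat by rewrite -(pos_place cw) // pos_top.
rewrite -[a in LHS]/(nat_of_ord (Ordinal aN)) (emb_place cw) /with_z eqxx.
by rewrite (tnth_nth 0) aE.
Qed.

Lemma E_permute_other v l s k : k != l -> E k (@permute_level v l s) = E k v.
Proof.
move=> kl; rewrite /E /with_z; congr emb; apply: funext => a.
by rewrite permute_other.
Qed.

(** H stands for the layers above m, which the first m symmetrizations do not
    affect. *)
Lemma foldr_Sym_layers (H : vars F lam -> F) m v :
  (m <= N')%N ->
  (forall y l s, (0 < l <= m)%N -> H (@permute_level y l s) = H y) ->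
  foldr (fun k g => Defs.Sym k g)
    (fun y => (\prod_(1 <= l < m.+1) layer w l (E l.+1 y) (E l y)) * H y)
    (iota 1 m) v
  = partialW v m (E m.+1 v) * H v.
Proof.
elim: m H v => [|m IH] H v mN Hinv; first by rewrite /= big_geq.
have -> : iota 1 m.+1 = iota 1 m ++ [:: m.+1] by rewrite -[m.+1]addn1 iotaD addnC.
rewrite foldr_cat foldr_SymC; last by rewrite mem_iota; lia.
pose H' y := layer w m.+1 (E m.+2 y) (E m.+1 y) * H y.
have -> : (fun y => (\prod_(1 <= l < m.+2) layer w l (E l.+1 y) (E l y)) * H y)
   = (fun y => (\prod_(1 <= l < m.+1) layer w l (E l.+1 y) (E l y)) * H' y).
  by apply: funext => y; rewrite big_nat_recr //= -mulrA.
rewrite /= /Defs.Sym mulr_suml; apply: eq_bigr => s _.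
have H'inv y l t : (0 < l <= m)%N -> H' (@permute_level y l t) = H' y.
  move=> lm; have nl : (m.+1 != l) && (m.+2 != l) by lia.
  by rewrite /H' !E_permute_other ?Hinv //; case/andP: nl => //; lia.
rewrite -/(permute_level v s) IH ?(ltnW mN) //.
rewrite partialW_permute // /H' Hinv ?leqnn // (@E_permute_other v m.+1 s m.+2); last by lia.
have -> : E m.+1 (permute_level v s) = emb w (fun a => v m.+1 (s a)).
  rewrite /E /with_z; congr emb; apply: funext => a.
  by rewrite ifF ?permute_same //; apply/eqP; lia.
by rewrite mulrCA mulrA.
Qed.

Lemma weightW_partial v : weightW br w v u P = partialW v N' (tnth u).
Proof.
have := @foldr_Sym_layers (fun=> 1) N' v (leqnn _) (fun _ _ _ _ => erefl).
rewrite mulr1 E_top => <-; rewrite /weightW.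
congr (foldr _ _ _ _); apply: funext => y.
rewrite mulr1 (weightU_layer cw).
rewrite -(big_mkord (fun l => 0 < l)%N (fun l => layer w l (E l.+1 y) (E l y))).
rewrite big_ltn_cond //= big_nat_cond [RHS]big_nat_cond.
by apply: eq_bigl => l; case: l.
Qed.

End Symmetrization.

(** * Separating the two positions *)

Section Decomposition.
Implicit Types (w : n.-tuple 'I_N) (S : {set 'I_n}) (Y : 'I_n -> F)
  (G : 'I_n -> 'I_n -> F).

(** What remains of a double product over S and S' when the four factors with both
    indices in {i, i1} are removed. *)
Definition rest S S' G : F :=
  (\prod_(m in S' :\ i :\ i1) (G i m * G i1 m))
  * (\prod_(k in S :\ i :\ i1) (G k i * G k i1))
  * prod2 (S :\ i :\ i1) (S' :\ i :\ i1) G.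

Lemma prod_pair S (f : 'I_n -> F) : i \in S -> i1 \in S ->
  \prod_(k in S) f k = f i * f i1 * \prod_(k in S :\ i :\ i1) f k.
Proof.
move=> iS i1S; rewrite (big_setD1 i iS) (big_setD1 i1) /= ?mulrA //.
by rewrite !inE i1S eq_sym neq_ii1.
Qed.

Lemma prod2_pair S S' G : i \in S -> i1 \in S -> i \in S' -> i1 \in S' ->
  prod2 S S' G = (G i i * G i i1 * (G i1 i * G i1 i1)) * rest S S' G.
Proof.
move=> iS i1S iS' i1S'; rewrite /prod2 (prod_pair _ iS i1S) /rest /prod2.
rewrite !(prod_pair _ iS' i1S') big_split /=.
under [X in _ * X]eq_bigr => k _ do rewrite (prod_pair _ iS' i1S').
rewrite big_split /=; ring.
Qed.

Lemma eq_rest S S' G G' :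
    (forall m, m != i -> m != i1 -> G i m * G i1 m = G' i m * G' i1 m) ->
    (forall k, k != i -> k != i1 -> G k i * G k i1 = G' k i * G' k i1) ->
    (forall k m, k != i -> k != i1 -> m != i -> m != i1 -> G k m = G' k m) ->
  rest S S' G = rest S S' G'.
Proof.
move=> h1 h2 h3; congr (_ * _ * _).
- by apply: eq_bigr => m /setD1P[mi1 /setD1P[mi _]]; apply: h1.
- by apply: eq_bigr => k /setD1P[ki1 /setD1P[ki _]]; apply: h2.
apply: eq_bigr => k /setD1P[ki1 /setD1P[ki _]].
by apply: eq_bigr => m /setD1P[mi1 /setD1P[mi _]]; apply: h3.
Qed.

Definition swapv Y : 'I_n -> F := fun k => Y (tperm i i1 k).

Lemma swapvi Y : swapv Y i = Y i1. Proof. by rewrite /swapv tpermL. Qed.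
Lemma swapvi1 Y : swapv Y i1 = Y i. Proof. by rewrite /swapv tpermR. Qed.
Lemma swapv_out Y k : k != i -> k != i1 -> swapv Y k = Y k.
Proof. by move=> ki ki1; rewrite /swapv tpermD // eq_sym. Qed.

Lemma ltn_i k : k != i -> k != i1 -> (k < i1)%N = (k < i)%N.
Proof. by move=> ki ki1; case: (compare_ii1 ki ki1) => _ ->. Qed.
Lemma ltn_i1 k : k != i -> k != i1 -> (i1 < k)%N = (i < k)%N.
Proof. by move=> ki ki1; case: (compare_ii1 ki ki1) => ->. Qed.

(** No third position lies between i and i1, so it compares in the same way with
    both, and the interchange of their variables permutes the factors. *)
Lemma rest_phi_bottom w l S S' Y' Y :
  rest S S' (phi w l Y' (swapv Y)) = rest S S' (phi w l Y' Y).
Proof.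
apply: eq_rest => [m mi mi1|k ki ki1|k m ki ki1 mi mi1]; rewrite /phi.
- rewrite !(eq_sym _ m) (negbTE mi) (negbTE mi1) ltn_i1 // swapvi swapvi1.
  by case: ifP => _; rewrite mulrC.
- by rewrite (negbTE ki) (negbTE ki1) swapv_out.
- by rewrite swapv_out.
Qed.

Lemma rest_phi_top w l S S' Y' Y :
  rest S S' (phi w l (swapv Y') Y) = rest S S' (phi w l Y' Y).
Proof.
apply: eq_rest => [m mi mi1|k ki ki1|k m ki ki1 mi mi1]; rewrite /phi.
- by rewrite !(eq_sym _ m) (negbTE mi) (negbTE mi1) swapv_out.
- rewrite (negbTE ki) (negbTE ki1) ltn_i // swapvi swapvi1.
  by case: ifP => _; rewrite mulrC.
- by rewrite swapv_out.
Qed.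

Lemma rest_rho S S' Y : rest S S' (rho (swapv Y)) = rest S S' (rho Y).
Proof.
apply: eq_rest => [m mi mi1|k ki ki1|k m ki ki1 mi mi1]; rewrite /rho.
- rewrite ltn_i1 // swapvi swapvi1 swapv_out //.
  by case: ifP => _; rewrite mulrC.
- rewrite ltn_i // swapvi swapvi1 swapv_out //.
  by case: ifP => _; rewrite mulrC.
- by rewrite !swapv_out.
Qed.

Lemma rest_phi_word w w' l S S' Y' Y :
  (forall k, k != i -> k != i1 -> dyn w l k = dyn w' l k) ->
  rest S S' (phi w l Y' Y) = rest S S' (phi w' l Y' Y).
Proof.
move=> ww'; apply: eq_rest => [m mi mi1|k ki ki1|k m ki ki1 mi mi1]; rewrite /phi.
- by rewrite !(eq_sym _ m) (negbTE mi) (negbTE mi1).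
- by rewrite (negbTE ki) (negbTE ki1).
- by rewrite ww'.
Qed.

Definition layer_rest w l Y' Y : F :=
  rest (Iup w l) (Iup w l.+1) (phi w l Y' Y) * rest (Iup w l) (Iup w l) (rho Y).

(** The factors with both positions in {i, i1} form [kern]; the others are
    symmetric in the two variables of either level. *)
Lemma layer_kern w l Y' Y : i \in Iup w l -> i1 \in Iup w l ->
  layer w l Y' Y
  = kern br (dyn w l i) (dyn w l i1) (Y' i) (Y' i1) (Y i) (Y i1) * layer_rest w l Y' Y.
Proof.
move=> iI i1I; have up k : k \in Iup w l -> k \in Iup w l.+1.
  by rewrite !in_Iup => /ltnW.
rewrite /layer !prod2_pair ?up // /layer_rest.
have lt : (i < i1)%N by rewrite i1E.
have lt' : (i1 < i)%N = false by rewrite i1E; lia.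
rewrite [phi _ _ _ _ i i]/phi [phi _ _ _ _ i i1]/phi [phi _ _ _ _ i1 i]/phi.
rewrite [phi _ _ _ _ i1 i1]/phi /rho !eqxx (negbTE neq_ii1) eq_sym.
rewrite (negbTE neq_ii1) lt lt' !ltnn /kern; ring.
Qed.

Lemma layer_rest_bottom w l Y' Y : layer_rest w l Y' (swapv Y) = layer_rest w l Y' Y.
Proof. by rewrite /layer_rest rest_phi_bottom rest_rho. Qed.

Lemma layer_rest_top w l Y' Y : layer_rest w l (swapv Y') Y = layer_rest w l Y' Y.
Proof. by rewrite /layer_rest rest_phi_top. Qed.

End Decomposition.

Section Dynamical.
Variable w : n.-tuple 'I_N.

(** Total weight of the labels to the right of both positions; it does not change
    when the two labels are interchanged. *)
Definition tailC (j k : 'I_N) : int :=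
  \sum_(m < n | (i1 < m)%N) epsh (tnth w m) j k.

Lemma epshB (m j j' k : 'I_N) : epsh m j k - epsh m j' k = epsh m j j'.
Proof. by rewrite /epsh; ring. Qed.

Lemma tailCB (j j' k : 'I_N) : tailC j k - tailC j' k = tailC j j'.
Proof.
by rewrite /tailC -sumrB; apply: eq_bigr => m _; rewrite epshB.
Qed.

Lemma Cshift_i1 k : Cshift w i1 k = tailC (tnth w i1) k.
Proof. by []. Qed.

Lemma Cshift_i k :
  Cshift w i k = epsh (tnth w i1) (tnth w i) k + tailC (tnth w i) k.
Proof.
rewrite /Cshift (bigD1 i1) ?i1E //=; congr (_ + _); apply: eq_bigl => m.
by rewrite -val_eqE /= i1E; lia.
Qed.

End Dynamical.

Lemma tailC_swapw w j k : tailC (swapw w) j k = tailC w j k.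
Proof.
apply: eq_bigr => m im; rewrite tnth_swapw tpermD // -val_eqE /=; move: im; rewrite i1E; lia.
Qed.

Lemma dyn_swapw w l k : k != i -> k != i1 -> dyn (swapw w) l k = dyn w l k.
Proof.
move=> ki ki1; have wk : tnth (swapw w) k = tnth w k.
  by rewrite tnth_swapw tpermD // eq_sym.
rewrite /dyn wk; congr (_ - _%:~R); rewrite /Cshift wk.
rewrite [LHS](reindex_inj (@perm_inj _ tau)) /=; apply: eq_big => [m|m _].
  rewrite /tau; case: tpermP => [->|->|//]; by rewrite ltn_i.
by rewrite tnth_swapw tpermK.
Qed.

Hypothesis hP : forall j k l, P j k + P k l = P j l.

(** The parameter (P+h)_(a,b), shifted by the labels to the right of i1, for the
    labels a and b of w at i and i1: the dynamical parameter of the R-matrix. *)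
Definition sdyn (w : n.-tuple 'I_N) : F :=
  P (tnth w i) (tnth w i1) - (tailC w (tnth w i) (tnth w i1))%:~R.

Lemma epsh_other (m j k : 'I_N) : m != j -> m != k -> epsh m j k = 0.
Proof. by rewrite /epsh => /negbTE-> /negbTE->. Qed.

(** On the levels that contain both labels the parameters of the two positions differ
    by the level-independent quantity [sdyn]: this is what makes the transport step
    reproduce the same R-matrix. *)
Lemma dyn_i w l : tnth w i != tnth w i1 -> tnth w i1 != inord l ->
  dyn w l i = dyn w l i1 + sdyn w.
Proof.
move=> ab bl; rewrite /dyn Cshift_i Cshift_i1 epsh_other 1?eq_sym //; last by rewrite eq_sym.
rewrite add0r /sdyn -(hP _ (tnth w i1)) -(tailCB w (tnth w i) (tnth w i1) (inord l)) rmorphB /=; ring.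
Qed.

Lemma dyn_swapw_i1 w l : tnth w i != tnth w i1 -> tnth w i1 != inord l ->
  dyn (swapw w) l i1 = dyn w l i.
Proof.
move=> ab bl; rewrite /dyn Cshift_i Cshift_i1 tailC_swapw tnth_swapw tpermR.
by rewrite epsh_other ?add0r // eq_sym.
Qed.

Lemma dyn_swapw_i w l : tnth w i != tnth w i1 -> tnth w i != inord l ->
  dyn (swapw w) l i = dyn w l i1.
Proof.
move=> ab al; rewrite /dyn Cshift_i Cshift_i1 tailC_swapw !tnth_swapw tpermR tpermL.
by rewrite epsh_other ?add0r.
Qed.

(** The label b at i1 lies to the right of i and is the label of the level, whence
    the shift by 1. *)
Lemma dyn_i_top w : tnth w i != tnth w i1 ->
  dyn w (tnth w i1) i = sdyn w + 1.
Proof.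
move=> ab; rewrite /dyn inord_val Cshift_i /sdyn rmorphD /= /epsh eqxx eq_sym (negbTE ab) /=.
by rewrite sub0r rmorphN /=; ring.
Qed.

Lemma dyn_swapw_i1_top w :
  dyn (swapw w) (tnth w i1) i1 = sdyn w.
Proof. by rewrite /dyn inord_val Cshift_i1 tailC_swapw tnth_swapw tpermR. Qed.

Lemma dyn_i_same w l : tnth w i = tnth w i1 -> tnth w i != inord l ->
  dyn w l i + 1 = dyn w l i1.
Proof.
move=> ab al; rewrite /dyn Cshift_i Cshift_i1 -ab /epsh eqxx (negbTE al) subr0.
by rewrite rmorphD /=; ring.
Qed.

Hypothesis br2 : rank_two br.
Hypothesis brD0 : forall x y, br x = 0 -> br y = 0 -> br (x + y) = 0.
Hypothesis genP : forall j k, j != k -> forall m : int, br (P j k + m%:~R) != 0.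

(** * The exchange of two neighbouring labels *)

Section Exchange.
Variable v : vars F lam.
Arguments v : clear implicits.
Hypothesis genv : forall l, (0 < l < N)%N -> forall a b : 'I_(lamU lam l),
  a != b -> br (v l b - v l a) != 0.

Local Notation perm_vars w l s := (emb w (fun a => v l (fun_of_perm s a))).

(** Doubling the sum allows each permutation to be paired with its composite with
    the transposition of the two variables. *)
Lemma sum_pair w (cw : counted w) l (f : ('I_n -> F) -> F) :
  i \in Iup w l -> i1 \in Iup w l ->
  2 * (\sum_(s : 'S_(lamU lam l)) f (perm_vars w l s))
  = \sum_(s : 'S_(lamU lam l)) (f (perm_vars w l s) + f (swapv (perm_vars w l s))).
Proof.
move=> iI i1I; have [t ht] := swap_places cw iI i1I.
rewrite big_split mulrDl !mul1r /=; congr (_ + _).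
rewrite (reindex_inj (mulgI t)); apply: eq_bigr => s _; congr f.
rewrite /swapv; transitivity (emb w (fun a => v l (s (t a)))).
  by congr emb; apply: funext => a; rewrite permM.
exact: (emb_perm (fun a => v l (s a)) ht).
Qed.

Lemma gap_neq0 w (cw : counted w) l (s : 'S_(lamU lam l)) :
  (0 < l < N)%N -> i \in Iup w l -> i1 \in Iup w l ->
  br (perm_vars w l s i - perm_vars w l s i1) != 0.
Proof.
move=> lN /(place_ex cw) [a al ai] /(place_ex cw) [b bl bi].
rewrite -{1}ai -{1}bi -[a]/(nat_of_ord (Ordinal al)) -[b]/(nat_of_ord (Ordinal bl)).
rewrite !(emb_place cw); apply: genv => //; rewrite (inj_eq perm_inj).
rewrite -val_eqE /= -(place_inj cw bl al) ai bi eq_sym; exact: neq_ii1.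
Qed.

Lemma exch_sum (I : finType) s D (f g f' g' : I -> F) :
  (forall j, exch br s D (f j) (g j) (f' j) (g' j)) ->
  exch br s D (\sum_j f j) (\sum_j g j) (\sum_j f' j) (\sum_j g' j).
Proof.
move=> h; rewrite /exch !mulr_sumr -!big_split.
by split; apply: eq_bigr => j _; have [] := h j.
Qed.

Lemma exch_scale c s D f g f' g' :
  exch br s D f g f' g' -> exch br s D (c * f) (c * g) (c * f') (c * g').
Proof.
case=> h1 h2; split.
  by apply: (eq_comb1 c h1); ring.
by apply: (eq_comb1 c h2); ring.
Qed.

Lemma sdyn_neq0 w (c : int) : tnth w i != tnth w i1 -> br (sdyn w + c%:~R) != 0.
Proof. by move=> ab; rewrite /sdyn -addrA -rmorphN -rmorphD; apply: genP. Qed.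

Lemma neq_inord (l : nat) (a : 'I_N) : (l < N)%N -> (a < l)%N -> a != inord l.
Proof. by move=> lN al; rewrite -val_eqE /= inordK //; lia. Qed.

(** The zeros of the bracket form a group, so translating by a zero preserves being
    nonzero. *)
Lemma br_gap D d : br d != 0 -> br D = 0 -> br (D + d) != 0 /\ br (d - D) != 0.
Proof.
move=> d0 D0; have ND0 : br (- D) = 0 by rewrite (brN br2) D0 oppr0.
split; apply: contra_neq d0 => h.
  by rewrite -(addKr D d) brD0.
by rewrite -(subrK D d) brD0.
Qed.

Lemma exch_step w (cw : counted w) m Y' :
  (tnth w i < tnth w i1)%N -> (tnth w i1 < m.+1 < N)%N ->
  (forall Y, exch br (sdyn w) (Y i - Y i1)
     (partialW w v m Y) (partialW (swapw w) v m Y)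
     (partialW w v m (swapv Y)) (partialW (swapw w) v m (swapv Y))) ->
  exch br (sdyn w) (Y' i - Y' i1)
     (partialW w v m.+1 Y') (partialW (swapw w) v m.+1 Y')
     (partialW w v m.+1 (swapv Y')) (partialW (swapw w) v m.+1 (swapv Y')).
Proof.
move=> ab /andP[bl lN] IH; set l := m.+1.
have nab : tnth w i != tnth w i1 by rewrite -val_eqE /=; lia.
have al : tnth w i != inord l by apply: neq_inord => //; apply: ltn_trans bl.
have bl' : tnth w i1 != inord l by exact: neq_inord.
have iI : i \in Iup w l by rewrite in_Iup (ltn_trans ab).
have i1I : i1 \in Iup w l by rewrite in_Iup.
have up k : k \in Iup w l -> k \in Iup w l.+1 by rewrite !in_Iup => /ltnW.
have iI' : i \in Iup (swapw w) l by rewrite in_Iup tnth_swapw tpermL -in_Iup.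
have i1I' : i1 \in Iup (swapw w) l by rewrite in_Iup tnth_swapw tpermR -in_Iup.
have two0 : (2 : F) != 0 by rewrite pnatr_eq0.
suff : exch br (sdyn w) (Y' i - Y' i1)
     (2 * partialW w v l Y') (2 * partialW (swapw w) v l Y')
     (2 * partialW w v l (swapv Y')) (2 * partialW (swapw w) v l (swapv Y')).
  by move/(exch_scale 2^-1); rewrite !mulKf.
have embE s : perm_vars (swapw w) l s = perm_vars w l s by rewrite emb_swapw_both.
have pairE w0 Z : counted w0 -> i \in Iup w0 l -> i1 \in Iup w0 l ->
    2 * partialW w0 v l Z
    = \sum_(s : 'S_(lamU lam l)) (layer_rest w0 l Z (perm_vars w0 l s) *
       (kern br (dyn w0 l i) (dyn w0 l i1) (Z i) (Z i1) (perm_vars w0 l s i) (perm_vars w0 l s i1)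
          * partialW w0 v m (perm_vars w0 l s)
        + kern br (dyn w0 l i) (dyn w0 l i1) (Z i) (Z i1) (perm_vars w0 l s i1) (perm_vars w0 l s i)
          * partialW w0 v m (swapv (perm_vars w0 l s)))).
  move=> cw0 i0 i10.
  rewrite /= (sum_pair cw0 (fun Y => layer w0 l Z Y * partialW w0 v m Y)) //.
  apply: eq_bigr => s _; rewrite !layer_kern // layer_rest_bottom swapvi swapvi1; ring.
rewrite !pairE //; try exact: counted_swapw.
apply: exch_sum => s; rewrite !embE !layer_rest_top.
have restE : layer_rest (swapw w) l Y' (perm_vars w l s) = layer_rest w l Y' (perm_vars w l s).
  rewrite /layer_rest !Iup_swapw_both ?up //.
  by congr (_ * _); apply: rest_phi_word => k ki ki1; apply: dyn_swapw.
rewrite restE !(dyn_swapw_i1 nab bl') !(dyn_swapw_i nab al) !(swapvi Y') !(swapvi1 Y').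
apply: exch_scale.
have al_eq := dyn_i nab bl'.
apply: (kern_exch br2) => //.
- by rewrite -[sdyn w]addr0; apply: (sdyn_neq0 0).
- by apply: gap_neq0; rewrite // lN.
- by move=> D0; apply: br_gap D0; apply: gap_neq0; rewrite // lN.
Qed.

(** If i1 does not occur up to level l + 1, then no comparison between i and i1 is
    made, and the words w and [swapw w] differ by a renaming of positions.  The
    dynamical parameters agree because the label at i1 pairs to zero with the labels
    involved. *)
Lemma layer_below w l Y' Y : (l < N)%N -> (tnth w i != tnth w i1) ->
  i1 \notin Iup w l.+1 ->
  layer (swapw w) l (swapv Y') (swapv Y) = layer w l Y' Y.
Proof.
move=> lN ab i1I'.
have i1I : i1 \notin Iup w l by apply: contra i1I'; rewrite !in_Iup => /ltnW.
have nI : ~~ ((i \in Iup w l) && (i1 \in Iup w l)) by rewrite (negbTE i1I) andbF.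
have nI' : ~~ ((i \in Iup w l.+1) && (i1 \in Iup w l.+1)) by rewrite (negbTE i1I') andbF.
have up k : k \in Iup w l -> k \in Iup w l.+1 by rewrite !in_Iup => /ltnW.
have re (l0 : nat) (G : 'I_n -> F) : \prod_(k in Iup (swapw w) l0) G k
    = \prod_(k in Iup w l0) G (tau k).
  rewrite (reindex_inj (@perm_inj _ tau)) /=.
  by apply: eq_bigl => k; rewrite in_Iup_swap.
rewrite /layer /prod2; congr (_ * _).
  rewrite re; apply: eq_bigr => k kI; rewrite re; apply: eq_bigr => m mI.
  rewrite /phi (inj_eq perm_inj) /swapv !tpermK (ltn_tperm nI' (up _ kI) mI).
  suff -> : dyn (swapw w) l (tau k) = dyn w l k by [].
  have [ki | ki] := eqVneq k i.
    rewrite ki /tau tpermL dyn_swapw_i1 //.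
    by move: i1I'; rewrite in_Iup -val_eqE /= inordK //; lia.
  have ki1 : k != i1 by apply: contraNneq i1I => <-.
  by rewrite tau_out // dyn_swapw.
rewrite re; apply: eq_bigr => k kI; rewrite re; apply: eq_bigr => m mI.
by rewrite /rho /swapv !tpermK (ltn_tperm nI).
Qed.

Lemma partialW_below w (cw : counted w) m Y :
  tnth w i != tnth w i1 -> (m.+1 < N)%N -> i1 \notin Iup w m.+1 ->
  partialW (swapw w) v m (swapv Y) = partialW w v m Y.
Proof.
move=> ab; elim: m Y => [|m IH] Y mN i1I //=.
have i1I' : i1 \notin Iup w m.+1 by apply: contra i1I; rewrite !in_Iup => /ltnW.
apply: eq_bigr => s _.
rewrite emb_swapw //; last by rewrite (negbTE i1I') andbF.
by rewrite -/(swapv _) layer_below ?IH //; apply: ltnW.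
Qed.

(** Analogue of [rest] when S contains i but not i1. *)
Definition rest1 (S S' : {set 'I_n}) (G : 'I_n -> 'I_n -> F) : F :=
  (\prod_(m in S' :\ i :\ i1) G i m) * (\prod_(k in S :\ i) (G k i * G k i1))
  * prod2 (S :\ i) (S' :\ i :\ i1) G.

Lemma prod2_single (S S' : {set 'I_n}) G : i \in S -> i \in S' -> i1 \in S' ->
  prod2 S S' G = G i i * G i i1 * rest1 S S' G.
Proof.
move=> iS iS' i1S'; rewrite /prod2 (big_setD1 i iS) /= (prod_pair _ iS' i1S').
under [X in _ * X]eq_bigr => k _ do rewrite (prod_pair _ iS' i1S').
by rewrite big_split /= /rest1 /prod2 !mulrA.
Qed.

Lemma eq_rest1 (S S' : {set 'I_n}) (G G' : 'I_n -> 'I_n -> F) : i1 \notin S ->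
    (forall m, m != i -> m != i1 -> G i m = G' i m) ->
    (forall k, k != i -> k != i1 -> G k i * G k i1 = G' k i * G' k i1) ->
    (forall k m, k != i -> k != i1 -> m != i -> m != i1 -> G k m = G' k m) ->
  rest1 S S' G = rest1 S S' G'.
Proof.
move=> i1S h1 h2 h3.
have ki1 k : k \in S -> k != i1 by move=> kS; apply: contraNneq i1S => <-.
congr (_ * _ * _).
- by apply: eq_bigr => m /setD1P[mi1 /setD1P[mi _]]; apply: h1.
- by apply: eq_bigr => k /setD1P[ki kS]; apply: h2 => //; apply: ki1.
apply: eq_bigr => k /setD1P[ki kS].
by apply: eq_bigr => m /setD1P[mi1 /setD1P[mi _]]; apply: h3 => //; apply: ki1.
Qed.

Lemma prod_swapw w l (G : 'I_n -> F) :
  \prod_(k in Iup (swapw w) l) G k = \prod_(k in Iup w l) G (tau k).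
Proof.
rewrite (reindex_inj (@perm_inj _ tau)) /=.
by apply: eq_bigl => k; rewrite in_Iup_swap.
Qed.

(** On level b the word w has a variable at i and [swapw w] has it at i1.  The layer
    from there to level b + 1 is the same factor for both words, symmetric in the
    two upper variables, times the functions compared in [exch_base]. *)
Lemma exch_first w (cw : counted w) m Y' :
  (tnth w i < tnth w i1)%N -> m.+1 = tnth w i1 :> nat ->
  exch br (sdyn w) (Y' i - Y' i1)
     (partialW w v m.+1 Y') (partialW (swapw w) v m.+1 Y')
     (partialW w v m.+1 (swapv Y')) (partialW (swapw w) v m.+1 (swapv Y')).
Proof.
move=> ab lE; set l := m.+1.
have lN : (l < N)%N by rewrite /l lE.
have nab : tnth w i != tnth w i1 by rewrite -val_eqE /=; lia.
have iI : i \in Iup w l by rewrite in_Iup /l lE.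
have i1I : i1 \notin Iup w l by rewrite in_Iup /l lE ltnn.
have nI : ~~ ((i \in Iup w l) && (i1 \in Iup w l)) by rewrite (negbTE i1I) andbF.
have iI' : i \in Iup w l.+1 by rewrite in_Iup /l lE ltnW.
have i1I' : i1 \in Iup w l.+1 by rewrite in_Iup /l lE.
have lt : (i < i1)%N by rewrite i1E.
have lt' : (i1 < i)%N = false by rewrite i1E; lia.
have inl : inord l = tnth w i1 by apply: val_inj; rewrite /= inordK.
have dynE k : dyn w l k = dyn w (tnth w i1) k by rewrite /l lE.
have dynE' k : dyn (swapw w) l k = dyn (swapw w) (tnth w i1) k by rewrite /l lE.
pose R Z Y := rest1 (Iup w l) (Iup w l.+1) (phi w l Z Y) * prod2 (Iup w l) (Iup w l) (rho Y).
have R_swap Z Y : R (swapv Z) Y = R Z Y.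
  rewrite /R; congr (_ * _); apply: eq_rest1 => // [k ki ki1|k ki ki1|k k' ki ki1 ki' ki1'].
  - by rewrite /phi swapv_out.
  - rewrite /phi (negbTE ki) (negbTE ki1) ltn_i // swapvi swapvi1.
    by case: ifP => _; rewrite mulrC.
  - by rewrite /phi swapv_out.
have layerE Z Y : layer w l Z Y = R Z Y *
    (br (Z i - Y i + (sdyn w + 1)) * br 1 / br (sdyn w + 1) * br (Z i1 - Y i)).
  rewrite /layer prod2_single // /R [phi _ _ _ _ i i]/phi [phi _ _ _ _ i i1]/phi.
  by rewrite eqxx (negbTE neq_ii1) lt dynE dyn_i_top //; ring.
have layerE' Z Y : layer (swapw w) l Z (swapv Y) = R Z Y *
    (br (Z i - Y i + 1) * (br (Z i1 - Y i + sdyn w) * br 1 / br (sdyn w))).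
  have -> : layer (swapw w) l Z (swapv Y)
      = prod2 (Iup w l) (Iup w l.+1) (fun k k' => phi (swapw w) l Z (swapv Y) (tau k) k')
        * prod2 (Iup w l) (Iup w l) (rho Y).
    rewrite /layer /prod2 (Iup_swapw_both iI' i1I') prod_swapw; congr (_ * _).
    rewrite prod_swapw; apply: eq_bigr => k kI; rewrite prod_swapw; apply: eq_bigr => k' k'I.
    by rewrite /rho /swapv !tpermK (ltn_tperm nI).
  rewrite prod2_single // /R.
  have -> : rest1 (Iup w l) (Iup w l.+1)
      (fun k k' => phi (swapw w) l Z (swapv Y) (tau k) k')
    = rest1 (Iup w l) (Iup w l.+1) (phi w l Z Y).
    apply: eq_rest1 => // [k ki ki1|k ki ki1|k k' ki ki1 ki' ki1']; rewrite /phi.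
    - by rewrite /tau tpermL swapvi1 !(eq_sym _ k) (negbTE ki) (negbTE ki1) ltn_i1.
    - by rewrite tau_out // (negbTE ki) (negbTE ki1) swapv_out.
    - by rewrite tau_out // swapv_out // dyn_swapw.
  rewrite /phi /tau tpermL swapvi1 eqxx lt' (eq_sym i1) (negbTE neq_ii1).
  by rewrite dynE' dyn_swapw_i1_top; ring.
have topE Z : partialW w v l Z = \sum_(s : 'S_(lamU lam l))
   R Z (perm_vars w l s) * partialW w v m (perm_vars w l s)
   * (br (Z i - perm_vars w l s i + (sdyn w + 1)) * br 1 / br (sdyn w + 1)
      * br (Z i1 - perm_vars w l s i)).
  by apply: eq_bigr => s _; rewrite layerE mulrAC.
have topE' Z : partialW (swapw w) v l Z = \sum_(s : 'S_(lamU lam l))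
   R Z (perm_vars w l s) * partialW w v m (perm_vars w l s)
   * (br (Z i - perm_vars w l s i + 1)
      * (br (Z i1 - perm_vars w l s i + sdyn w) * br 1 / br (sdyn w))).
  rewrite /=; apply: eq_bigr => s _.
  by rewrite emb_swapw // -/(swapv _) layerE' partialW_below // mulrAC.
rewrite !topE !topE'; apply: exch_sum => s; rewrite !R_swap.
apply: exch_scale; rewrite !swapvi !swapvi1; apply: (exch_base br2).
  by rewrite -[sdyn w]addr0; apply: (sdyn_neq0 0).
exact: (sdyn_neq0 1).
Qed.

Lemma exch_partial w (cw : counted w) m Y :
  (tnth w i < tnth w i1)%N -> (tnth w i1 <= m < N)%N ->
  exch br (sdyn w) (Y i - Y i1)
     (partialW w v m Y) (partialW (swapw w) v m Y)
     (partialW w v m (swapv Y)) (partialW (swapw w) v m (swapv Y)).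
Proof.
move=> ab; elim: m Y => [|m IH] Y /andP[bm mN]; first by lia.
have [bm1 | bm1] := eqVneq (tnth w i1 : nat) m.+1.
  exact: exch_first.
have bm2 : (tnth w i1 <= m)%N by lia.
apply: exch_step => //; first by rewrite ltnS bm2.
by move=> Z; apply: IH; rewrite bm2 ltnW.
Qed.

(** On the first level that contains the two equal labels nothing below lies at i or
    i1, so the symmetry is evident; [kern_sym] transports it upwards. *)
Lemma partialW_same w (cw : counted w) m Y :
  tnth w i = tnth w i1 -> (tnth w i <= m < N)%N ->
  partialW w v m (swapv Y) = partialW w v m Y.
Proof.
move=> ab; elim: m Y => [|m IH] Y /andP[am mN] //.
have [am1 | am1] := eqVneq (tnth w i : nat) m.+1.
  apply: eq_bigr => s _; congr (_ * _).
  have iI : i \notin Iup w m.+1 by rewrite in_Iup am1 ltnn.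
  have i1I : i1 \notin Iup w m.+1 by rewrite in_Iup -ab am1 ltnn.
  rewrite /layer; congr (_ * _); apply: eq_bigr => k kI.
  have ki : k != i by apply: contraNneq iI => <-.
  have ki1 : k != i1 by apply: contraNneq i1I => <-.
  have sw : swapw w = w.
    apply: eq_from_tnth => j; rewrite tnth_swapw.
    by case: tpermP => [->|->|].
  have reI (G : 'I_n -> F) :
      \prod_(k' in Iup w m.+2) G k' = \prod_(k' in Iup w m.+2) G (tau k').
    by rewrite -{1}sw prod_swapw.
  rewrite [LHS]reI; apply: eq_bigr => k' _.
  rewrite /phi /swapv tpermK /tau; case: tpermP => [->|->|//].
    by rewrite (negbTE ki) (negbTE ki1) ltn_i.
  by rewrite (negbTE ki) (negbTE ki1) ltn_i.
set l := m.+1.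
have al : tnth w i != inord l by apply: neq_inord; lia.
have iI : i \in Iup w l by rewrite in_Iup; lia.
have i1I : i1 \in Iup w l by rewrite in_Iup -ab; lia.
have two0 : (2 : F) != 0 by rewrite pnatr_eq0.
apply: (mulfI two0); rewrite /= -/l.
rewrite !(sum_pair cw (fun Z => layer w l _ Z * partialW w v m Z)) //.
apply: eq_bigr => s _; rewrite !layer_kern // !layer_rest_bottom !layer_rest_top.
rewrite IH; last by lia.
rewrite !swapvi !swapvi1 -(dyn_i_same ab al).
apply: (eq_comb1 (layer_rest w l Y (perm_vars w l s))
  (kern_sym br2 (dyn w l i) (perm_vars w l s i) (perm_vars w l s i1) (Y i) (Y i1)
     (partialW w v m (perm_vars w l s)))).
ring.
Qed.

End Exchange.

Lemma upd2_swap (T : Type) (s : n.-tuple T) k :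
  tnth (upd2 i i1 (tnth s i1) (tnth s i) s) k = tnth s (tperm i i1 k).
Proof.
rewrite tnth_mktuple; case: tpermP => [->|->|/eqP/negbTE-> /eqP/negbTE-> //].
  by rewrite eqxx.
by rewrite eq_sym (negbTE neq_ii1) eqxx.
Qed.

Lemma upd2_id (T : Type) (s : n.-tuple T) :
  upd2 i i1 (tnth s i) (tnth s i1) s = s.
Proof.
apply: eq_from_tnth => k; rewrite tnth_mktuple.
by case: eqP => [->//|_]; case: eqP => [->//|_].
Qed.

Lemma shiftP_tail (w : n.-tuple 'I_N) (j k : 'I_N) :
  epsh (tnth w i) j k + epsh (tnth w i1) j k = 0 ->
  shiftP w (fun m => if (i <= m)%N then -1 else 0) P j k = P j k - (tailC w j k)%:~R.
Proof.
move=> e0; rewrite /shiftP -rmorphN; congr (_ + _%:~R).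
rewrite (bigD1 i) //= (bigD1 i1) /=; last by rewrite eq_sym neq_ii1.
rewrite leqnn i1E leqnSn !mulN1r addrA -opprD e0 oppr0 add0r.
rewrite /tailC -sumrN big_mkcond [RHS]big_mkcond; apply: eq_bigr => m _.
rewrite -!val_eqE /= i1E.
by case: (ltngtP m i) => //= ?; case: (ltngtP m i.+1) => //= ?; 
   rewrite ?mul0r ?mulN1r //; lia.
Qed.

(** The R-matrix preserves the pair of labels, so that two words survive in the
    sum over all pairs. *)
Lemma sum_two (a b : 'I_N) (f : 'I_N -> 'I_N -> F) : a != b ->
  (forall m m1, (m, m1) != (a, b) -> (m, m1) != (b, a) -> f m m1 = 0) ->
  \sum_m \sum_m1 f m m1 = f a b + f b a.
Proof.
move=> ab f0; rewrite (bigD1 a) //= [X in _ + X](bigD1 b) /=; last by rewrite eq_sym.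
rewrite [X in _ + (_ + X)]big1 ?addr0; last first.
  move=> m /andP[ma mb]; rewrite big1 // => m1 _.
  by apply: f0; rewrite xpair_eqE ?(negbTE ma) ?(negbTE mb).
congr (_ + _).
  rewrite (bigD1 b) //= big1 ?addr0 // => m1 m1b.
  by apply: f0; rewrite xpair_eqE ?(negbTE m1b) ?andbF ?(negbTE ab).
rewrite (bigD1 a) //= big1 ?addr0 // => m1 m1a.
by apply: f0; rewrite xpair_eqE ?(negbTE m1a) ?andbF // eq_sym (negbTE ab).
Qed.

Lemma weightH_swap (v : vars F lam) (u : n.-tuple F) : lamU lam N = n ->
  weightH br v (upd2 i i1 (tnth u i1) (tnth u i) u) = weightH br v u.
Proof.
move=> lamN; apply: eq_bigr => l _; apply: eq_bigr => a _.
have lN' : (l == N :> nat) = false by apply/negbTE; rewrite neq_ltn ltn_ord.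
rewrite /with_z lN'; have [lN | //] := eqVneq l.+1 N.
rewrite lN lamN; pose f (z : F) := br (z - v l a + 1).
have E (s : n.-tuple F) : \prod_(b < n) f s`_b = \prod_(b < n) f (tnth s b).
  by apply: eq_bigr => b _; rewrite (tnth_nth 0).
rewrite -/(f _); transitivity (\prod_(b < n) f (tnth u b)); last by rewrite -E.
rewrite (E (upd2 _ _ _ _ _)) [RHS](reindex_inj (@perm_inj _ tau)).
by apply: eq_bigr => b _; rewrite upd2_swap.
Qed.

(** The top level carries the spectral parameters, and [exch] at that level is the
    R-matrix relation up to its denominators: the second relation if the labels
    increase, the first one, for the word [swapw mu], if they decrease. *)
Lemma weightWt_exchange (mu : n.-tuple 'I_N) (v : vars F lam) (u : n.-tuple F) :
  counted mu -> lamU lam N = n ->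
  (forall l : nat, (0 < l < N)%N -> forall a b : 'I_(lamU lam l), a != b ->
     br (v l b - v l a) != 0) ->
  br (tnth u i - tnth u i1 + 1) != 0 ->
  weightWt br (upd2 i i1 (tnth mu i1) (tnth mu i) mu) v
    (upd2 i i1 (tnth u i1) (tnth u i) u) P
  = \sum_(m : 'I_N) \sum_(m1 : 'I_N)
      Rbar br (tnth u i - tnth u i1)
        (shiftP mu (fun j => if (i <= j)%N then -1 else 0) P)
        (tnth mu i) (tnth mu i1) m m1
      * weightWt br (upd2 i i1 m m1 mu) v u P.
Proof.
move=> cmu lamN genv genR.
have cmu' := counted_swapw cmu.
have swE : upd2 i i1 (tnth mu i1) (tnth mu i) mu = swapw mu.
  by apply: eq_from_tnth => k; rewrite upd2_swap tnth_swapw.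
have usw : tnth (upd2 i i1 (tnth u i1) (tnth u i) u) = swapv (tnth u).
  by apply: funext => k; rewrite upd2_swap.
have topN (a : 'I_N) : (a <= N' < N)%N by rewrite leqnn andbT -ltnS ltn_ord.
rewrite swE /weightWt weightH_swap // weightW_partial // usw.
set D := tnth u i - tnth u i1 in genR *.
have [ab|ab|/val_inj ab] := ltngtP (tnth mu i) (tnth mu i1).
- have nab : tnth mu i != tnth mu i1 by rewrite -val_eqE /=; lia.
  have [_ E2] := exch_partial genv cmu (tnth u) ab (topN _).
  rewrite (sum_two nab) => [|m m1]; last first.
    rewrite !xpair_eqE => /negbTE h1 /negbTE h2.
    by rewrite /Rbar (negbTE nab) h1 h2 mul0r.
  rewrite /Rbar (negbTE nab) !eqxx ab eq_sym (negbTE nab) /=.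
  rewrite swE upd2_id !weightW_partial // shiftP_tail; last first.
    by rewrite /epsh !eqxx (eq_sym (tnth mu i1)) (negbTE nab).
  rewrite -/(sdyn mu); have s0 := sdyn_neq0 0 nab; rewrite addr0 in s0.
  rewrite -/D in E2; move: (_^-1) => h.
  have c0 : br (sdyn mu) ^+ 2 * br (D + 1) != 0 by rewrite mulf_neq0 ?expf_neq0.
  apply: (mulfI c0); rewrite [LHS]mulrA E2; field; exact/andP.
- have nab : tnth mu i != tnth mu i1 by rewrite -val_eqE /=; lia.
  have ab' : (tnth (swapw mu) i < tnth (swapw mu) i1)%N.
    by rewrite !tnth_swapw tpermL tpermR.
  have [E1 _] := exch_partial genv cmu' (tnth u) ab' (topN _).
  have sE : sdyn (swapw mu) = P (tnth mu i1) (tnth mu i)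
      - (tailC mu (tnth mu i1) (tnth mu i))%:~R.
    by rewrite /sdyn !tnth_swapw tpermL tpermR tailC_swapw.
  rewrite (sum_two nab) => [|m m1]; last first.
    rewrite !xpair_eqE => /negbTE h1 /negbTE h2.
    by rewrite /Rbar (negbTE nab) h1 h2 mul0r.
  have nab' : (tnth mu i < tnth mu i1)%N = false by lia.
  rewrite /Rbar (negbTE nab) !eqxx nab' eq_sym (negbTE nab) /=.
  rewrite swE upd2_id !weightW_partial // shiftP_tail; last first.
    by rewrite /epsh !eqxx (eq_sym (tnth mu i1) (tnth mu i)) (negbTE nab).
  rewrite -sE; have s0 : br (sdyn (swapw mu)) != 0.
    rewrite -[sdyn _]addr0; apply: (sdyn_neq0 0).
    by rewrite !tnth_swapw tpermL tpermR eq_sym.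
  rewrite swapwK -/D in E1; move: (_^-1) => h.
  have c0 : br (D + 1) * br (sdyn (swapw mu)) != 0 by rewrite mulf_neq0.
  apply: (mulfI c0); rewrite [LHS]mulrA E1; field; exact/andP.
have same := partialW_same v cmu (tnth u) ab.
rewrite (bigD1 (tnth mu i)) //= (bigD1 (tnth mu i1)) //=.
rewrite [X in _ + X + _]big1 => [|m1 m1b]; last first.
  by rewrite /Rbar ab eqxx (negbTE m1b) andbF mul0r.
rewrite [X in _ + X]big1 => [|m ma]; last first.
  by rewrite big1 // => m1 _; rewrite /Rbar ab eqxx -ab (negbTE ma) mul0r.
rewrite /Rbar {1}ab !eqxx mul1r !addr0 upd2_id !weightW_partial //.
have sw : swapw mu = mu.
  by apply: eq_from_tnth => j; rewrite tnth_swapw; case: tpermP => [->|->|].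
by rewrite sw same.
Qed.

End Weights.
End Level.
End Words.

(** * Complex modulus, exponential and limits *)

Section ComplexNorm.
Variable R : realType.
Implicit Types (x y z : R[i]).

(** The modulus with values in R, so that estimates take place in an ordered
    field. *)
Definition cnorm x : R := Normc.normc x.

Lemma cnormE x : `|x| = (cnorm x)%:C.
Proof. by rewrite normc_def; case: x. Qed.

Lemma cnorm_ge0 x : 0 <= cnorm x.
Proof. by rewrite -lecR -cnormE normr_ge0. Qed.

Lemma cnormM x y : cnorm (x * y) = cnorm x * cnorm y.
Proof. exact: Normc.normcM. Qed.

Lemma cnormD x y : cnorm (x + y) <= cnorm x + cnorm y.
Proof. exact: le_normcD. Qed.

Lemma cnormN x : cnorm (- x) = cnorm x.
Proof. exact: normcN. Qed.

Lemma cnormB x y : cnorm (x - y) <= cnorm x + cnorm y.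
Proof. by rewrite -(cnormN y) cnormD. Qed.

Lemma cnormC x y : cnorm (x - y) = cnorm (y - x).
Proof. by rewrite -cnormN opprB. Qed.

Lemma cnorm0 : cnorm 0 = 0. Proof. exact: Normc.normc0. Qed.
Lemma cnorm1 : cnorm 1 = 1. Proof. exact: Normc.normc1. Qed.

Lemma cnormV x : cnorm x^-1 = (cnorm x)^-1.
Proof. exact: Normc.normcV. Qed.

Lemma cnorm_eq0 x : (cnorm x == 0) = (x == 0).
Proof. by apply/eqP/eqP => [/Normc.eq0_normc //|->]; rewrite cnorm0. Qed.

Lemma cnorm_gt0 x : (0 < cnorm x) = (x != 0).
Proof. by rewrite lt0r cnorm_eq0 cnorm_ge0 andbT. Qed.

Lemma cnormX x n : cnorm (x ^+ n) = cnorm x ^+ n.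
Proof. by elim: n => [|n IH]; rewrite ?cnorm1 // !exprS cnormM IH. Qed.

Lemma cnorm_sum (I : Type) (r : seq I) (P : pred I) (f : I -> R[i]) :
  cnorm (\sum_(j <- r | P j) f j) <= \sum_(j <- r | P j) cnorm (f j).
Proof.
elim/big_rec2: _ => [|j y x _ IH]; first by rewrite cnorm0.
by apply: (le_trans (cnormD _ _)); rewrite lerD2l.
Qed.

Lemma cnorm_triangle x y z : cnorm (x - z) <= cnorm (x - y) + cnorm (y - z).
Proof. by rewrite -[x - z](subrKA y) cnormD. Qed.

Lemma cnorm_lower x y : cnorm y - cnorm x <= cnorm (x + y).
Proof. by rewrite lerBlDl -(cnormN x) -{1}(addKr x y) cnormD. Qed.

Lemma cnorm_Re_Im x : cnorm x <= `|complex.Re x| + `|complex.Im x|.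
Proof.
case: x => a b; rewrite /cnorm /=.
rewrite -[leRHS]ger0_norm ?addr_ge0 // -sqrtr_sqr ler_sqrt ?sqr_ge0 //.
have ab0 : 0 <= `|a| * `|b| by rewrite mulr_ge0.
rewrite sqrrD !real_normK ?num_real //; lra.
Qed.

Lemma Re_le_cnorm x : `|complex.Re x| <= cnorm x.
Proof.
case: x => a b; rewrite /cnorm /= -sqrtr_sqr ler_sqrt ?lerDl ?sqr_ge0 //.
by rewrite addr_ge0 ?sqr_ge0.
Qed.

Lemma Im_le_cnorm x : `|complex.Im x| <= cnorm x.
Proof.
case: x => a b; rewrite /cnorm /= -sqrtr_sqr ler_sqrt ?lerDr ?sqr_ge0 //.
by rewrite addr_ge0 ?sqr_ge0.
Qed.

Lemma cexpD x y : cexp (x + y) = cexp x * cexp y.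
Proof.
case: x => a b; case: y => c d; rewrite /cexp /= expRD cosD sinD.
by apply/eqP; rewrite eq_complex /=; apply/andP; split; apply/eqP; ring.
Qed.

Lemma cexp0 : cexp 0 = 1 :> R[i].
Proof. by rewrite /cexp /= expR0 cos0 sin0 mul1r. Qed.

Lemma cnorm_cexp x : cnorm (cexp x) = expR (complex.Re x).
Proof.
case: x => a b; rewrite /cexp cnormM /cnorm /= cos2Dsin2 sqrtr1 mulr1.
by rewrite expr0n addr0 sqrtr_sqr ger0_norm // expR_ge0.
Qed.

Lemma cexp_neq0 x : cexp x != 0.
Proof. by rewrite -cnorm_gt0 cnorm_cexp expR_gt0. Qed.

Lemma cexpN x : cexp (- x) = (cexp x)^-1.
Proof.
apply: (mulfI (cexp_neq0 x)); rewrite -cexpD subrr cexp0 divff //.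
exact: cexp_neq0.
Qed.

End ComplexNorm.

Section Sequences.
Variable R : realType.
Implicit Types (z w : nat -> R[i]) (l : R[i]).

(** Convergence with a real error; by [tendsP] it is convergence in the topology for
    which the infinite products are defined. *)
Definition tends z l : Prop :=
  forall e : R, 0 < e -> exists M, forall m, (M <= m)%N -> cnorm (z m - l) <= e.

Lemma tendsP z l : tends z l <-> ((z : nat -> R[i]^o) @ \oo --> (l : R[i]^o))%classic.
Proof.
split=> [zl | zl e e0].
  apply/cvgrPdistC_le => -[e e'] /= e0.
  move: e0; rewrite ltcE /= => /andP[/eqP -> e0].
  have [M hM] := zl _ e0; exists M => // m Mm.
  by rewrite /= cnormE lecE /= eqxx hM.
have e0' : 0 < e%:C by rewrite ltcR.
move/cvgrPdistC_le: zl => /(_ _ e0')[M _ hM].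
by exists M => m Mm; have := hM m Mm; rewrite /= cnormE lecR.
Qed.

Lemma tends_lim z l : tends z l -> lim ((z : nat -> R[i]^o) @ \oo)%classic = l.
Proof. by move/tendsP; apply: cvg_lim; apply: norm_hausdorff. Qed.

Lemma tends_uniq z l l' : tends z l -> tends z l' -> l = l'.
Proof. by move=> /tends_lim <- /tends_lim. Qed.

Lemma tendsM z w l l' : tends z l -> tends w l' -> tends (fun m => z m * w m) (l * l').
Proof.
by move=> /tendsP zl /tendsP wl; apply/tendsP; exact: (@cvgM R[i] nat \oo%classic _ z w l l' zl wl).
Qed.

Lemma tendsV z l : l != 0 -> tends z l -> tends (fun m => (z m)^-1) l^-1.
Proof. by move=> l0 /tendsP zl; apply/tendsP; apply: cvgV. Qed.

Lemma tends_cst l : tends (fun=> l) l.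
Proof. by move=> e e0; exists 0%N => m _; rewrite subrr cnorm0 ltW. Qed.

Lemma tends_comp z l (h : nat -> nat) :
  (forall M, exists M', forall m, (M' <= m)%N -> (M <= h m)%N) ->
  tends z l -> tends (z \o h) l.
Proof.
move=> hh zl e /zl[M hM]; have [M' hM'] := hh M.
by exists M' => m /hM' /hM.
Qed.

Lemma real_geom_cvg (a : nat -> R) (C rho : R) : 0 <= rho < 1 ->
  (forall m, `|a m.+1 - a m| <= C * rho ^+ m) ->
  exists l : R, forall e : R, 0 < e -> exists M, forall m, (M <= m)%N -> `|a m - l| <= e.
Proof.
move=> /andP[r0 r1] aC.
have C0 : 0 <= C by have := le_trans (normr_ge0 _) (aC 0%N); rewrite expr0 mulr1.
have cS : cvgn (series (telescope a)).
  apply: normed_cvg; apply: (@series_le_cvg _ _ (geometric C rho)) => //=.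
  - by move=> n /=; apply: mulr_ge0 => //; apply: exprn_ge0.
  - by apply: is_cvg_geometric_series; rewrite ger0_norm.
pose l := a 0%N + lim (series (telescope a) @ \oo)%classic.
exists l => e e0; move/cvgrPdistC_le: cS => /(_ _ e0)[M _ hM].
exists M => m Mm; have := hM m Mm; rewrite /= /l telescopeK /=.
by congr (`|_| <= _); ring.
Qed.

Lemma geom_tends z (C rho : R) : 0 <= rho < 1 ->
  (forall m, cnorm (z m.+1 - z m) <= C * rho ^+ m) -> exists l, tends z l.
Proof.
move=> rr zC.
have [||a ha] := @real_geom_cvg (fun m => complex.Re (z m)) C rho => //.
  by move=> m; apply: le_trans (zC m); rewrite -raddfB Re_le_cnorm.
have [||b hb] := @real_geom_cvg (fun m => complex.Im (z m)) C rho => //.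
  by move=> m; apply: le_trans (zC m); rewrite -raddfB Im_le_cnorm.
exists (a +i* b) => e e0; have e2 : 0 < e / 2 by rewrite divr_gt0.
have [M1 h1] := ha _ e2; have [M2 h2] := hb _ e2.
exists (maxn M1 M2) => m; rewrite geq_max => /andP[m1 m2].
apply: (le_trans (cnorm_Re_Im _)); rewrite [e]splitr.
by apply: lerD; [have := h1 m m1 | have := h2 m m2]; case: (z m).
Qed.

End Sequences.

(** * Infinite products *)

Section Product.
Variable R : realType.
Variable p : R[i].
Hypothesis p1 : cnorm p < 1.
Implicit Types x : R[i].

Definition pprod x m : R[i] := \prod_(0 <= k < m) (1 - x * p ^+ k).

Lemma pprodS x m : pprod x m.+1 = pprod x m * (1 - x * p ^+ m).
Proof. by rewrite /pprod big_nat_recr. Qed.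

Lemma geom_sum_le (rho : R) m : 0 <= rho < 1 ->
  \sum_(0 <= k < m) rho ^+ k <= (1 - rho)^-1.
Proof.
move=> /andP[r0 r1]; have r10 : 0 < 1 - rho by rewrite subr_gt0.
rewrite -[leRHS]mul1r ler_pdivlMr // mulrC.
have -> : (1 - rho) * (\sum_(0 <= k < m) rho ^+ k) = 1 - rho ^+ m.
  by rewrite -opprB mulNr big_mkord -subrX1 opprB.
by rewrite lerBlDr lerDl exprn_ge0.
Qed.

Lemma pprod_bound x : exists C : R, forall m, cnorm (pprod x m) <= C.
Proof.
exists (expR (cnorm x * (1 - cnorm p)^-1)) => m.
have h : cnorm (pprod x m) <= expR (cnorm x * \sum_(0 <= k < m) cnorm p ^+ k).
  elim: m => [|m IH]; first by rewrite /pprod !big_geq // cnorm1 mulr0 expR0.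
  rewrite pprodS cnormM big_nat_recr //= mulrDr expRD.
  apply: ler_pM => //; rewrite ?cnorm_ge0 //.
  apply: (le_trans (cnormB _ _)); rewrite cnorm1 cnormM cnormX.
  exact: expR_ge1Dx.
apply: (le_trans h); rewrite ler_expR ler_wpM2l ?cnorm_ge0 // geom_sum_le //.
by rewrite cnorm_ge0.
Qed.

Lemma pprod_tends x : tends (pprod x) (qpoch x p).
Proof.
have [C hC] := pprod_bound x.
have [l hl] : exists l, tends (pprod x) l.
  apply: (@geom_tends _ _ (C * cnorm x) (cnorm p)); first by rewrite cnorm_ge0.
  move=> m; rewrite pprodS mulrBr mulr1 addrC addKr cnormN !cnormM cnormX !mulrA.
  by rewrite !ler_wpM2r ?exprn_ge0 ?cnorm_ge0.
by rewrite /qpoch (tends_lim hl).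
Qed.

(** From the index K on, the factors differ from 1 by a total of at most 1/2, so the
    remaining product is at least 1/2 in modulus; the finitely many partial products
    before K are nonzero. *)
Lemma pprod_lower x : (forall k, x * p ^+ k != 1) ->
  exists2 c : R, 0 < c & forall m, c <= cnorm (pprod x m).
Proof.
move=> xp.
have pm0 m : pprod x m != 0.
  elim: m => [|m IH]; first by rewrite /pprod big_geq // oner_neq0.
  by rewrite pprodS mulf_neq0 // subr_eq0 eq_sym.
have p01 : 0 <= cnorm p < 1 by rewrite cnorm_ge0.
have q0 : 0 < 1 - cnorm p by rewrite subr_gt0.
have [K hK] : exists K, cnorm x * cnorm p ^+ K / (1 - cnorm p) <= 2^-1.
  have := @cvg_geometric R (cnorm x / (1 - cnorm p)) (cnorm p).
  rewrite ger0_norm ?cnorm_ge0 // => /(_ p1) /cvgrPdistC_le /(_ 2^-1).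
  rewrite invr_gt0 ltr0n => /(_ isT) [K _ hK]; exists K.
  have := hK K (leqnn K); rewrite /= subr0 => h; apply: le_trans h.
  by rewrite mulrAC ler_norm.
have tail j : cnorm (pprod x K) * (1 - cnorm x * cnorm p ^+ K * \sum_(0 <= k < j) cnorm p ^+ k)
    <= cnorm (pprod x (K + j)).
  elim: j => [|j IH]; first by rewrite big_geq // mulr0 subr0 mulr1 addn0.
  rewrite addnS pprodS cnormM big_nat_recr //=.
  set S := \sum_(0 <= k < j) _ in IH *; set a := cnorm x * cnorm p ^+ K in hK IH *.
  have Sj : S + cnorm p ^+ j <= (1 - cnorm p)^-1.
    by rewrite /S -big_nat_recr //= geom_sum_le.
  have a0 : 0 <= a by rewrite mulr_ge0 ?cnorm_ge0 ?exprn_ge0 ?cnorm_ge0.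
  have S0 : 0 <= S by apply: sumr_ge0 => k _; rewrite exprn_ge0 ?cnorm_ge0.
  have pj : 0 <= cnorm p ^+ j by rewrite exprn_ge0 ?cnorm_ge0.
  have aS : a * (S + cnorm p ^+ j) <= 2^-1.
    by apply: le_trans hK; rewrite ler_wpM2l.
  have f1 : 1 - a * cnorm p ^+ j <= cnorm (1 - x * p ^+ (K + j)).
    rewrite /a -mulrA -exprD -cnormX -cnormM -(cnormN (x * _)) -{1}(cnorm1 R).
    by have := cnorm_lower (- (x * p ^+ (K + j))) 1; rewrite (addrC _ 1).
  have n0 := cnorm_ge0 (pprod x K).
  have aj : 0 <= a * cnorm p ^+ j by rewrite mulr_ge0.
  have aS0 : 0 <= a * S by rewrite mulr_ge0.
  have h0 : 0 <= 1 - a * cnorm p ^+ j by rewrite mulrDr in aS; lra.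
  apply: (le_trans _ (ler_pM _ h0 IH f1)); last first.
    by rewrite mulr_ge0 //; rewrite mulrDr in aS; lra.
  by rewrite -[leRHS]mulrA; apply: ler_wpM2l => //; nra.
have low m : (K <= m)%N -> cnorm (pprod x K) / 2 <= cnorm (pprod x m).
  move=> /subnKC <-; apply: le_trans (tail _); rewrite ler_wpM2l ?cnorm_ge0 //.
  have := geom_sum_le (m - K) p01; set S := \sum_(_ <= _ < _) _ => hS.
  have : cnorm x * cnorm p ^+ K * S <= 2^-1.
    by apply: le_trans hK; rewrite ler_wpM2l // mulr_ge0 ?exprn_ge0 ?cnorm_ge0.
  lra.
have [c c0 hc] : exists2 c, 0 < c & forall m, (m < K)%N -> c <= cnorm (pprod x m).
  elim: (K) => [|k [c c0 hc]]; first by exists 1.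
  exists (Num.min c (cnorm (pprod x k))); first by rewrite lt_min c0 cnorm_gt0 pm0.
  move=> m; rewrite ltnS leq_eqVlt => /orP[/eqP->|mk]; first by rewrite ge_min lexx orbT.
  by rewrite ge_min hc.
exists (Num.min c (cnorm (pprod x K) / 2)).
  by rewrite lt_min c0 divr_gt0 // cnorm_gt0 pm0.
move=> m; have [Km|mK] := leqP K m; last by rewrite ge_min hc.
by rewrite ge_min low ?orbT.
Qed.

Lemma tends_lower (z : nat -> R[i]) l (c : R) :
  tends z l -> (forall m, c <= cnorm (z m)) -> c <= cnorm l.
Proof.
move=> zl cz; apply/ler_addgt0Pr => e /zl[M hM].
have := cnorm_triangle (z M) l 0; rewrite !subr0 => h.
by apply: (le_trans (cz M)); apply: (le_trans h); rewrite addrC lerD2l hM.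
Qed.

Lemma qpoch_neq0 x : (forall k, x * p ^+ k != 1) -> qpoch x p != 0.
Proof.
move=> /pprod_lower[c c0 hc]; rewrite -cnorm_gt0 (lt_le_trans c0) //.
exact: tends_lower (pprod_tends x) hc.
Qed.

Lemma qpoch_eq0 x k : x * p ^+ k = 1 -> qpoch x p = 0.
Proof.
move=> xk; apply: (tends_uniq (pprod_tends x)) => e e0; exists k.+1 => m km.
suff -> : pprod x m = 0 by rewrite subrr cnorm0 ltW.
by rewrite /pprod (@big_cat_nat _ _ _ k.+1) //= big_nat_recr //= xk subrr mulr0 mul0r.
Qed.

End Product.

(** * Unordered sums *)

Section UnorderedSums.
Variable R : realType.

Definition bounded_sums (T : eqType) (b : T -> R) : Prop :=
  exists B : R, forall s, uniq s -> \sum_(t <- s) b t <= B.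

(** Absolute convergence without an order on the index set: the sums below run over
    Z and Z^2 and are reindexed by bijections that preserve no exhaustion. *)
Definition hsum (T : eqType) (f : T -> R[i]) (S : R[i]) : Prop :=
  bounded_sums (fun t => cnorm (f t)) /\
  forall e : R, 0 < e -> exists2 s0, uniq s0 &
    forall s, uniq s -> {subset s0 <= s} -> cnorm (\sum_(t <- s) f t - S) <= e.

Lemma sum_subset_split (V : nmodType) (T : eqType) (f : T -> V) (s s' : seq T) :
  uniq s -> uniq s' -> {subset s <= s'} ->
  \sum_(t <- s') f t = \sum_(t <- s) f t + \sum_(t <- [seq t <- s' | t \notin s]) f t.
Proof.
move=> us us' ss'; rewrite -big_cat; apply: perm_big; apply: uniq_perm => //.
  rewrite cat_uniq us filter_uniq // andbT /=; apply/hasPn => t.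
  by rewrite mem_filter => /andP[].
move=> t; rewrite mem_cat mem_filter.
by have [/ss' -> |] := boolP (t \in s).
Qed.

Lemma sum_subset_le (T : eqType) (b : T -> R) (s s' : seq T) :
  (forall t, 0 <= b t) -> uniq s -> uniq s' -> {subset s <= s'} ->
  \sum_(t <- s) b t <= \sum_(t <- s') b t.
Proof.
by move=> b0 us us' ss'; rewrite (sum_subset_split b us us' ss') lerDl sumr_ge0.
Qed.

(** Any finite set whose sum is within e of the supremum of all finite sums has this
    property. *)
Lemma bounded_sums_tail (T : eqType) (b : T -> R) (e : R) :
  (forall t, 0 <= b t) -> bounded_sums b -> 0 < e ->
  exists2 s0, uniq s0 &
    forall s, uniq s -> (forall t, t \in s -> t \notin s0) -> \sum_(t <- s) b t <= e.
Proof.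
move=> b0 [B hB] e0.
pose E := [set x : R | exists2 s, uniq s & x = \sum_(t <- s) b t]%classic.
have supE : has_sup E.
  split; first by exists 0, [::] => //; rewrite big_nil.
  by exists B => _ [s us ->]; apply: hB.
have [_ [s0 us0 ->] h] := sup_adherent e0 supE.
exists s0 => // s us ss0.
have us' : uniq (s0 ++ s).
  by rewrite cat_uniq us0 us andbT /=; apply/hasPn => t /ss0.
have : \sum_(t <- s0 ++ s) b t <= sup E.
  by apply: sup_upper_bound => //; exists (s0 ++ s).
rewrite big_cat /=; move: h; set x := \sum_(t <- s0) _; set y := \sum_(t <- s) _.
lra.
Qed.

Lemma hsum_uniq (T : eqType) (f : T -> R[i]) S S' : hsum f S -> hsum f S' -> S = S'.
Proof.
move=> [_ h] [_ h']; apply/eqP; rewrite -subr_eq0 -cnorm_eq0.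
rewrite eq_le cnorm_ge0 andbT; apply/ler_addgt0Pr => e e0; rewrite add0r.
have e2 : 0 < e / 2 by rewrite divr_gt0.
have [s us hs] := h _ e2; have [s' us' hs'] := h' _ e2.
have su : {subset s <= undup (s ++ s')} by move=> t ts; rewrite mem_undup mem_cat ts.
have su' : {subset s' <= undup (s ++ s')}.
  by move=> t ts; rewrite mem_undup mem_cat ts orbT.
have a := hs _ (undup_uniq _) su; have b := hs' _ (undup_uniq _) su'.
apply: (le_trans (cnorm_triangle _ (\sum_(t <- undup (s ++ s')) f t) _)).
by rewrite cnormC [e]splitr lerD.
Qed.

Lemma bounded_sums_inj (T U : eqType) (h : U -> T) (b : T -> R) :
  injective h -> bounded_sums b -> bounded_sums (b \o h).
Proof.
move=> hi [B hB]; exists B => s us; rewrite -(big_map h xpredT b).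
by apply: hB; rewrite map_inj_uniq.
Qed.

Lemma hsum_reindex (T U : eqType) (h : U -> T) (g : T -> U) (f : T -> R[i]) S :
  cancel h g -> cancel g h -> hsum f S -> hsum (f \o h) S.
Proof.
move=> hK gK [bf hf]; split.
  exact: (bounded_sums_inj (can_inj hK) bf).
move=> e /hf[s0 us0 hs0]; exists (map g s0); first by rewrite map_inj_uniq //; apply: can_inj gK.
move=> s us ss; rewrite -(big_map h xpredT f); apply: hs0.
  by rewrite map_inj_uniq //; apply: can_inj hK.
move=> t ts; rewrite -[t]gK; apply: map_f; apply: ss; exact: map_f.
Qed.

Lemma eq_hsum (T : eqType) (f g : T -> R[i]) S : f =1 g -> hsum f S -> hsum g S.
Proof. by move=> /funext ->. Qed.

Lemma hsumZ (T : eqType) (c : R[i]) (f : T -> R[i]) S :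
  hsum f S -> hsum (fun t => c * f t) (c * S).
Proof.
move=> [[B hB] hf]; split.
  exists (cnorm c * B) => s us; under eq_bigr => t _ do rewrite cnormM.
  by rewrite -mulr_sumr ler_wpM2l ?cnorm_ge0 // hB.
move=> e e0; have c0 : 0 < cnorm c + 1 by rewrite ltr_wpDl // cnorm_ge0.
have [s0 us0 hs0] := hf (e / (cnorm c + 1)) (divr_gt0 e0 c0).
exists s0 => // s us ss; rewrite -mulr_sumr -mulrBr cnormM.
apply: le_trans (_ : (cnorm c + 1) * (e / (cnorm c + 1)) <= _); last first.
  by rewrite mulrC divfK // gt_eqF.
by apply: ler_pM; rewrite ?cnorm_ge0 ?hs0 // lerDl.
Qed.

Lemma hsumD (T : eqType) (f g : T -> R[i]) S S' :
  hsum f S -> hsum g S' -> hsum (fun t => f t + g t) (S + S').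
Proof.
move=> [[B hB] hf] [[B' hB'] hg]; split.
  exists (B + B') => s us.
  apply: le_trans (_ : \sum_(t <- s) (cnorm (f t) + cnorm (g t)) <= _).
    by apply: ler_sum => t _; apply: cnormD.
  by rewrite big_split lerD ?hB ?hB'.
move=> e e0; have e2 : 0 < e / 2 by rewrite divr_gt0.
have [s us hs] := hf _ e2; have [s' us' hs'] := hg _ e2.
exists (undup (s ++ s')); first exact: undup_uniq.
move=> t ut st; rewrite big_split /= opprD addrACA.
apply: (le_trans (cnormD _ _)); rewrite [e]splitr; apply: lerD.
  by apply: hs => // x xs; apply: st; rewrite mem_undup mem_cat xs.
by apply: hs' => // x xs; apply: st; rewrite mem_undup mem_cat xs orbT.
Qed.

Lemma hsum_ge0 (T : eqType) (b : T -> R) :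
  (forall t, 0 <= b t) -> bounded_sums b ->
  exists S, hsum (fun t => (b t)%:C) S.
Proof.
move=> b0 bb; have cb t : cnorm (b t)%:C = b t.
  by rewrite /cnorm /= expr0n addr0 sqrtr_sqr ger0_norm.
have [B hB] := bb.
pose E := [set x : R | exists2 s, uniq s & x = \sum_(t <- s) b t]%classic.
have supE : has_sup E.
  split; first by exists 0, [::] => //; rewrite big_nil.
  by exists B => _ [s us ->]; apply: hB.
exists (sup E)%:C; split; first by exists B => s us; under eq_bigr do rewrite cb; apply: hB.
move=> e e0; have [_ [s0 us0 ->] h] := sup_adherent e0 supE.
exists s0 => // s us ss.
rewrite -rmorph_sum -rmorphB /= /cnorm /= expr0n addr0 sqrtr_sqr.
have h1 : \sum_(t <- s) b t <= sup E by apply: sup_upper_bound => //; exists s.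
have h2 := sum_subset_le b0 us0 us ss.
by rewrite ler_norml; apply/andP; split; lra.
Qed.

(** Real and imaginary parts split into positive and negative parts, whose sums are
    suprema of finite sums. *)
Lemma hsum_exists (T : eqType) (f : T -> R[i]) :
  bounded_sums (fun t => cnorm (f t)) -> exists S, hsum f S.
Proof.
move=> bf.
have dom (b : T -> R) : (forall t, 0 <= b t <= cnorm (f t)) ->
    exists S, hsum (fun t => (b t)%:C) S.
  move=> bb; apply: hsum_ge0 => [t|]; first by case/andP: (bb t).
  have [B hB] := bf; exists B => s us; apply: le_trans (hB s us).
  by apply: ler_sum => t _; case/andP: (bb t).
have pos (g : T -> R) : (forall t, `|g t| <= cnorm (f t)) ->
    exists S, hsum (fun t => (g t)%:C) S.
  move=> gf.
  have [|S hS] := dom (fun t => Num.max (g t) 0).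
  - move=> t; rewrite le_max lexx orbT ge_max cnorm_ge0 andbT.
    by apply: le_trans (gf t); apply: ler_norm.
  have [|S' hS'] := dom (fun t => Num.max (- g t) 0).
  - move=> t; rewrite le_max lexx orbT ge_max cnorm_ge0 andbT.
    by apply: le_trans (gf t); rewrite -normrN; apply: ler_norm.
  exists (S + -1 * S'); apply: eq_hsum (hsumD hS (hsumZ (-1) hS')) => t.
  rewrite mulN1r -rmorphB /=; congr (_%:C).
  by case: (leP (g t) 0) => g0; case: (leP (- g t) 0) => g1; lra.
have [|A hA] := pos (fun t => complex.Re (f t)); first by move=> t; apply: Re_le_cnorm.
have [|B hB] := pos (fun t => complex.Im (f t)); first by move=> t; apply: Im_le_cnorm.
exists (A + 'i%C * B); apply: eq_hsum (hsumD hA (hsumZ 'i%C hB)) => t.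
by rewrite -complexE.
Qed.

Lemma hsum_sumtype (T U : eqType) (f : T + U -> R[i]) S S' :
  hsum (f \o inl) S -> hsum (f \o inr) S' -> hsum f (S + S').
Proof.
pose L (s : seq (T + U)) := pmap (fun x => if x is inl t then Some t else None) s.
pose K (s : seq (T + U)) := pmap (fun x => if x is inr t then Some t else None) s.
have LP s t : (t \in L s) = (inl t \in s).
  elim: s => [|[x|x] s IH] //=; rewrite ?inE ?IH //.
have KP s t : (t \in K s) = (inr t \in s).
  elim: s => [|[x|x] s IH] //=; rewrite ?inE ?IH //.
have uL s : uniq s -> uniq (L s).
  elim: s => [|[x|x] s IH] //= /andP[xs us]; rewrite -/(L s) IH // andbT.
  by rewrite LP.
have uK s : uniq s -> uniq (K s).
  elim: s => [|[x|x] s IH] //= /andP[xs us]; rewrite -/(K s) IH // andbT.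
  by rewrite KP.
have split (V : nmodType) (g : T + U -> V) s :
    \sum_(x <- s) g x = \sum_(t <- L s) g (inl t) + \sum_(t <- K s) g (inr t).
  elim: s => [|[x|x] s IH] /=; rewrite ?big_nil ?addr0 // !big_cons IH.
    by rewrite addrA.
  by rewrite addrCA.
move=> [[B hB] hf] [[B' hB'] hg]; split.
  exists (B + B') => s us; rewrite split lerD //; [exact/hB/uL | exact/hB'/uK].
move=> e e0; have e2 : 0 < e / 2 by rewrite divr_gt0.
have [s us hs] := hf _ e2; have [s' us' hs'] := hg _ e2.
exists (map inl s ++ map inr s').
  rewrite cat_uniq !map_inj_uniq ?us ?us' => [|x y [] //|x y [] //].
  by rewrite andbT /=; apply/hasPn => _ /mapP[x _ ->]; apply/negP => /mapP[].
move=> t ut st; rewrite split opprD addrACA.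
apply: (le_trans (cnormD _ _)); rewrite [e]splitr; apply: lerD.
  apply: hs; first exact: uL.
  by move=> x xs; rewrite LP; apply: st; rewrite mem_cat map_f.
apply: hs'; first exact: uK.
by move=> x xs; rewrite KP; apply: st; rewrite mem_cat map_f ?orbT.
Qed.

Lemma sum_allpairs (V : pzRingType) (T U : eqType) (f : T -> V) (g : U -> V) s s' :
  \sum_(x <- [seq (t, u) | t <- s, u <- s']) f x.1 * g x.2
  = (\sum_(t <- s) f t) * (\sum_(u <- s') g u).
Proof.
rewrite big_allpairs_dep /= mulr_suml; apply: eq_bigr => t _.
by rewrite mulr_sumr.
Qed.

(** A finite set s of pairs is compared with a product set A x C that contains it; the
    pairs of A x C outside s have a component outside a large finite set, hence a
    small total. *)
Lemma hsum_prod (T U : eqType) (f : T -> R[i]) (g : U -> R[i]) S S' :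
  hsum f S -> hsum g S' -> hsum (fun x : T * U => f x.1 * g x.2) (S * S').
Proof.
move=> [bf hf] [bg hg].
have [B0 hB0] := bf; have [B0' hB0'] := bg.
have B_ge0 : 0 <= B0 by have := hB0 [::] isT; rewrite big_nil.
have B_ge0' : 0 <= B0' by have := hB0' [::] isT; rewrite big_nil.
have up (A : seq T) (C : seq U) : uniq A -> uniq C -> uniq [seq (t, u) | t <- A, u <- C].
  by move=> uA uC; rewrite allpairs_uniq // => -[? ?] [? ?] _ _ [-> ->].
have cfg0 (x : T * U) : 0 <= cnorm (f x.1 * g x.2) by apply: cnorm_ge0.
have memp (A : seq T) (C : seq U) (x : T * U) :
    (x \in [seq (t, u) | t <- A, u <- C]) = (x.1 \in A) && (x.2 \in C).
  apply/allpairsP/andP => [[y [yA yC ->]]|[xA xC]] //.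
  by exists x; split => //; case: x {xA xC}.
split.
  exists (B0 * B0') => s us.
  pose A := undup (map fst s); pose C := undup (map snd s).
  apply: le_trans (_ : \sum_(x <- [seq (t, u) | t <- A, u <- C]) cnorm (f x.1 * g x.2) <= _).
    apply: sum_subset_le => //; first by rewrite up ?undup_uniq.
    by move=> x xs; rewrite memp !mem_undup !map_f.
  under eq_bigr => x _ do rewrite cnormM.
  rewrite (sum_allpairs (fun t => cnorm (f t)) (fun u => cnorm (g u))).
  apply: ler_pM; rewrite ?sumr_ge0 => // *; rewrite ?cnorm_ge0 //.
    by rewrite hB0 ?undup_uniq.
  by rewrite hB0' ?undup_uniq.
move=> e e0; pose Q := B0 + B0' + cnorm S + 1.
have S0 : 0 <= cnorm S := cnorm_ge0 _.
have Q0 : 0 < Q by rewrite /Q; lra.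
have d0 : 0 < e / (4 * Q) by rewrite divr_gt0 // mulr_gt0.
set d := e / (4 * Q) in d0.
have dQ : d * Q = e / 4 by rewrite /d; field; rewrite gt_eqF.
have [t1 ut1 ht1] := hf _ d0; have [u1 uu1 hu1] := hg _ d0.
have [t2 ut2 ht2] := bounded_sums_tail (fun t => cnorm_ge0 (f t)) bf d0.
have [u2 uu2 hu2] := bounded_sums_tail (fun u => cnorm_ge0 (g u)) bg d0.
pose t0 := undup (t1 ++ t2); pose u0 := undup (u1 ++ u2).
exists [seq (t, u) | t <- t0, u <- u0]; first by rewrite up ?undup_uniq.
move=> s us ss.
pose A := undup (map fst s ++ t0); pose C := undup (map snd s ++ u0).
have uA : uniq A by apply: undup_uniq.
have uC : uniq C by apply: undup_uniq.
have sAC : {subset s <= [seq (t, u) | t <- A, u <- C]}.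
  by move=> x xs; rewrite memp !mem_undup !mem_cat !map_f.
pose A' := [seq t <- A | t \notin t0]; pose C' := [seq u <- C | u \notin u0].
have SA : cnorm (\sum_(t <- A) f t - S) <= d.
  apply: ht1 => // t tt; rewrite mem_undup mem_cat mem_undup mem_cat tt orbT //.
have SC : cnorm (\sum_(u <- C) g u - S') <= d.
  apply: hu1 => // u uu; rewrite mem_undup mem_cat mem_undup mem_cat uu orbT //.
have TA : \sum_(t <- A') cnorm (f t) <= d.
  apply: ht2; rewrite ?filter_uniq // => t; rewrite mem_filter mem_undup mem_cat.
  by rewrite negb_or => /andP[/andP[]].
have TC : \sum_(u <- C') cnorm (g u) <= d.
  apply: hu2; rewrite ?filter_uniq // => u; rewrite mem_filter mem_undup mem_cat.
  by rewrite negb_or => /andP[/andP[]].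
have hAC := sum_subset_split (fun x : T * U => f x.1 * g x.2) us (up _ _ uA uC) sAC.
rewrite sum_allpairs in hAC.
set D := [seq x <- _ | _] in hAC.
have DB : cnorm (\sum_(x <- D) f x.1 * g x.2) <= d * B0' + B0 * d.
  apply: le_trans (cnorm_sum _ _ _) _.
  have uD : uniq D by rewrite filter_uniq // up.
  have u1' : uniq [seq (t, u) | t <- A', u <- C] by rewrite up // filter_uniq.
  have u2' : uniq [seq (t, u) | t <- A, u <- C'] by rewrite up // filter_uniq.
  apply: le_trans (_ : \sum_(x <- undup ([seq (t, u) | t <- A', u <- C] ++ [seq (t, u) | t <- A, u <- C'])) cnorm (f x.1 * g x.2) <= _).
    apply: sum_subset_le => //; first exact: undup_uniq.
    move=> x; rewrite mem_filter => /andP[xs]; rewrite memp => /andP[xA xC].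
    rewrite mem_undup mem_cat !memp !mem_filter xA xC !andbT -negb_and.
    by apply: contra xs => /andP[xt xu]; apply: ss; rewrite memp xt.
  have sle (s1 s2 : seq (T * U)) : uniq s1 -> uniq s2 ->
     \sum_(x <- undup (s1 ++ s2)) cnorm (f x.1 * g x.2)
     <= \sum_(x <- s1) cnorm (f x.1 * g x.2) + \sum_(x <- s2) cnorm (f x.1 * g x.2).
    move=> us1 us2; rewrite (@sum_subset_split _ _ _ s1) ?undup_uniq //; last first.
      by move=> x xs; rewrite mem_undup mem_cat xs.
    rewrite lerD2l; apply: sum_subset_le; rewrite ?filter_uniq ?undup_uniq //.
    by move=> x; rewrite mem_filter mem_undup mem_cat => /andP[/negbTE->].
  apply: (le_trans (sle _ _ u1' u2')).
  under eq_bigr => x _ do rewrite cnormM.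
  under [X in _ + X]eq_bigr => x _ do rewrite cnormM.
  rewrite !(sum_allpairs (fun t => cnorm (f t)) (fun u => cnorm (g u))).
  by apply: lerD; apply: ler_pM; rewrite ?sumr_ge0 ?hB0 ?hB0' // => *; apply: cnorm_ge0.
have -> : \sum_(x <- s) f x.1 * g x.2 - S * S'
   = (\sum_(t <- A) f t - S) * (\sum_(u <- C) g u) + S * (\sum_(u <- C) g u - S')
     + - \sum_(x <- D) f x.1 * g x.2.
  by rewrite mulrBl hAC; ring.
have gC : cnorm (\sum_(u <- C) g u) <= B0'.
  by apply: le_trans (cnorm_sum _ _ _) _; apply: hB0'.
apply: (le_trans (cnormD _ _)); rewrite cnormN.
apply: (le_trans (lerD (cnormD _ _) DB)); rewrite !cnormM.
have h1 : cnorm (\sum_(t <- A) f t - S) * cnorm (\sum_(u <- C) g u) <= d * B0'.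
  by apply: ler_pM; rewrite ?cnorm_ge0.
have h2 : cnorm S * cnorm (\sum_(u <- C) g u - S') <= cnorm S * d.
  by rewrite ler_wpM2l.
have h3 : d * B0 <= d * Q by rewrite ler_wpM2l ?ltW // /Q; lra.
have h4 : d * B0' <= d * Q by rewrite ler_wpM2l ?ltW // /Q; lra.
have h5 : d * cnorm S <= d * Q by rewrite ler_wpM2l ?ltW // /Q; lra.
rewrite (mulrC B0) (mulrC (cnorm S) d) in h2 *.
lra.
Qed.

Lemma tends_sum (T : eqType) (f : nat -> T -> R[i]) (g : T -> R[i]) (s : seq T) :
  (forall t, tends (fun m => f m t) (g t)) ->
  tends (fun m => \sum_(t <- s) f m t) (\sum_(t <- s) g t).
Proof.
move=> fg; elim: s => [|t s IH] e e0.
  by exists 0%N => m _; rewrite !big_nil subrr cnorm0 ltW.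
have e2 : 0 < e / 2 by rewrite divr_gt0.
have [M1 h1] := fg t _ e2; have [M2 h2] := IH _ e2.
exists (maxn M1 M2) => m; rewrite geq_max => /andP[m1 m2].
rewrite !big_cons opprD addrACA; apply: (le_trans (cnormD _ _)).
by rewrite [e]splitr lerD ?h1 ?h2.
Qed.

(** Tannery's theorem: dominated convergence for unordered sums. *)
Lemma hsum_dominated (T : eqType) (f : nat -> T -> R[i]) (supp : nat -> seq T)
    (g : T -> R[i]) (b : T -> R) (S : R[i]) :
  (forall m t, cnorm (f m t) <= b t) -> bounded_sums b ->
  (forall m, uniq (supp m)) -> (forall m t, t \notin supp m -> f m t = 0) ->
  (forall t, tends (fun m => f m t) (g t)) ->
  tends (fun m => \sum_(t <- supp m) f m t) S ->
  hsum g S.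
Proof.
move=> fb bb us fs fg fS.
have b0 t : 0 <= b t by apply: le_trans (fb 0%N t); apply: cnorm_ge0.
have gb t : cnorm (g t) <= b t.
  apply/ler_addgt0Pr => e e0; have [M hM] := fg t e e0.
  apply: (le_trans _ (lerD (fb M t) (hM M (leqnn M)))); rewrite cnormC.
  by have := cnormD (f M t) (g t - f M t); rewrite subrKC.
split.
  by have [B hB] := bb; exists B => s us'; apply: le_trans (hB s us'); apply: ler_sum.
move=> e e0; have d0 : 0 < e / 3 by rewrite divr_gt0.
have [s0 us0 h0] := bounded_sums_tail b0 bb d0.
exists s0 => // s us' ss.
have [M1 h1] := tends_sum s fg d0; have [M2 h2] := fS _ d0.
pose m := maxn M1 M2; pose U := undup (s ++ supp m).
have e1 := sum_subset_split (f m) us' (undup_uniq (s ++ supp m)).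
have e2 := sum_subset_split (f m) (us m) (undup_uniq (s ++ supp m)).
have {}e1 := e1 (fun t ts => ltac:(by rewrite mem_undup mem_cat ts)).
have {}e2 := e2 (fun t ts => ltac:(by rewrite mem_undup mem_cat ts orbT)).
rewrite e1 [X in _ = _ + X]big1_seq ?addr0 in e2; last first.
  by move=> t; rewrite mem_filter => /andP[_ /andP[/fs]].
have tl : cnorm (\sum_(t <- [seq t <- undup (s ++ supp m) | t \notin s]) f m t) <= e / 3.
  apply: le_trans (cnorm_sum _ _ _) _.
  apply: le_trans (h0 [seq t <- undup (s ++ supp m) | t \notin s] _ _); last 2 first.
  - by rewrite filter_uniq ?undup_uniq.
  - by move=> t; rewrite mem_filter => /andP[ts _]; apply: contra ts => /ss.
  by apply: ler_sum => t _.
have -> : \sum_(t <- s) g t - S = - (\sum_(t <- s) f m t - \sum_(t <- s) g t)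
   + (\sum_(t <- supp m) f m t - S)
   - \sum_(t <- [seq t <- undup (s ++ supp m) | t \notin s]) f m t.
  by rewrite -e2; ring.
have a1 := h1 m (leq_maxl _ _); have a2 := h2 m (leq_maxr _ _).
apply: (le_trans (cnormB _ _)); apply: (le_trans (lerD (cnormD _ _) (lexx _))).
rewrite cnormN; lra.
Qed.

End UnorderedSums.

(** * Gaussian sums and the q-binomial theorem *)

Section GaussianBound.
Variable R : realType.

Lemma bounded_geom_int (rho : R) : 0 <= rho < 1 ->
  bounded_sums (fun n : int => rho ^+ `|n|%N).
Proof.
move=> r01; have /andP[r0 r1] := r01; exists ((1 - rho)^-1 + (1 - rho)^-1) => s us.
have [M sM] : exists M, forall n, n \in s -> (`|n| < M)%N.
  exists (\max_(n <- s) `|n|%N).+1 => n ns.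
  by rewrite ltnS; apply: (@leq_bigmax_seq _ s xpredT (fun n : int => `|n|%N)).
pose s' := map Posz (iota 0 M) ++ map Negz (iota 0 M).
apply: le_trans (_ : \sum_(n <- s') rho ^+ `|n|%N <= _).
  apply: sum_subset_le => //; first by move=> n; apply: exprn_ge0.
    rewrite cat_uniq !map_inj_uniq ?iota_uniq /= => [|x y [] //|x y [] //].
    by rewrite andbT; apply/hasPn => _ /mapP[k _ ->]; apply/negP => /mapP[].
  move=> [k|k] /sM /= kM; rewrite mem_cat; apply/orP; [left|right];
    by apply: map_f; rewrite mem_iota /=; lia.
rewrite big_cat !big_map /=; apply: lerD.
  have := geom_sum_le M r01; by rewrite /index_iota subn0.
apply: le_trans (geom_sum_le M r01); rewrite /index_iota subn0.
by apply: ler_sum => k _; rewrite ler_wiXn2l // ltW.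
Qed.

Lemma Re_mulC (x : R[i]) (y : R) : complex.Re (x * y%:C) = complex.Re x * y.
Proof. by case: x => a b /=; rewrite mulr0 subr0. Qed.

Lemma intrC (n : int) : (n%:~R : R[i]) = (n%:~R : R)%:C.
Proof. by rewrite rmorph_int. Qed.

(** Completing the square, the real part of the exponent is at most K - |n| for a constant K. *)
Lemma gauss_bounded (w0 w1 w2 : R[i]) : complex.Re w2 < 0 ->
  bounded_sums (fun n : int => cnorm (cexp (w0 + w1 * n%:~R + w2 * n%:~R ^+ 2))).
Proof.
move=> w20; set a := - complex.Re w2; have a0 : 0 < a by rewrite oppr_gt0.
set c : R := `|complex.Re w1| + 1.
pose K := complex.Re w0 + c ^+ 2 / (4 * a).
have rho1 : 0 <= (expR (-1) : R) < 1.
  by rewrite expR_ge0 -[ltRHS]expR0 ltr_expR ltrN10.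
have [B hB] := bounded_geom_int rho1; exists (expR K * B) => s us.
apply: le_trans (_ : expR K * \sum_(n <- s) expR (-1) ^+ `|n|%N <= _); last first.
  by rewrite ler_wpM2l ?expR_ge0 // hB.
rewrite mulr_sumr; apply: ler_sum => n _.
rewrite cnorm_cexp -expRM_natl -expRD ler_expR !raddfD /= intrC -rmorphXn !Re_mulC.
have tE : (`|n|%N%:R : R) = `|n%:~R| by rewrite natr_absz intr_norm.
rewrite tE; set t := `|n%:~R|.
have -> : (n%:~R : R) ^+ 2 = t ^+ 2 by rewrite real_normK ?num_real.
have h1 : complex.Re w1 * n%:~R <= `|complex.Re w1| * t.
  by apply: le_trans (ler_norm _) _; rewrite normrM.
have h2 : 0 <= (2 * a * t - c) ^+ 2 / (4 * a) by rewrite divr_ge0 ?sqr_ge0 // mulr_ge0 ?ltW.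
have h3 : (2 * a * t - c) ^+ 2 / (4 * a) = a * t ^+ 2 - c * t + c ^+ 2 / (4 * a).
  by field; rewrite gt_eqF.
have h4 : complex.Re w2 = - a by rewrite /a opprK.
have cE : `|complex.Re w1| = c - 1 by rewrite /c addrK.
rewrite /K h4; move: h1 h2; rewrite h3 cE; clearbody c a t.
move: (c ^+ 2 / (4 * a)) => k; lra.
Qed.

End GaussianBound.

Section QBinomial.
Variables (F : fieldType) (p : F).

Definition qfact m : F := \prod_(0 <= k < m) (1 - p * p ^+ k).

(** Extended by 0 for j > M, so that Pascal's rule [qbinS] includes the last
    coefficient. *)
Definition qbin M j : F :=
  if (j <= M)%N then qfact M / (qfact j * qfact (M - j)) else 0.

Lemma qfactS m : qfact m.+1 = qfact m * (1 - p ^+ m.+1).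
Proof. by rewrite /qfact big_nat_recr //= exprS. Qed.

Hypothesis qfact0 : forall m, qfact m != 0.

Lemma qfact00 : qfact 0 = 1. Proof. by rewrite /qfact big_geq. Qed.

Lemma qbin0 M : qbin M 0 = 1.
Proof. by rewrite /qbin subn0 qfact00 mul1r divff. Qed.

Lemma qbinS M j : (j <= M)%N ->
  qbin M.+1 j.+1 = qbin M j.+1 + p ^+ (M - j) * qbin M j.
Proof.
move=> jM; rewrite /qbin ltnS jM; have := jM; rewrite leq_eqVlt => /orP[/eqP->|jM1].
  by rewrite ltnn !subnn qfact00 expr0 add0r mul1r !mulr1 !divff.
have [d dE] : exists d, M = (j.+1 + d)%N by exists (M - j.+1)%N; rewrite subnKC.
have e1 : (M.+1 - j.+1 = d.+1)%N by lia.
have e2 : (M - j.+1 = d)%N by lia.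
have e3 : (M - j = d.+1)%N by lia.
rewrite jM1 e1 e2 e3 !qfactS.
have : qfact d.+1 != 0 by []. have : qfact j.+1 != 0 by []. 
rewrite !qfactS !mulf_eq0 !negb_or => /andP[j0 j1] /andP[d0 d1].
have -> : p ^+ M.+1 = p ^+ j.+1 * p ^+ d.+1 by rewrite -exprD; congr (_ ^+ _); lia.
field; rewrite j0 j1 d0 d1 //.
Qed.

Lemma qbinomial x M :
  \prod_(0 <= k < M) (1 + x * p ^+ k)
  = \sum_(0 <= j < M.+1) qbin M j * ((\prod_(0 <= k < j) p ^+ k) * x ^+ j).
Proof.
elim: M => [|M IH].
  by rewrite big_geq // big_nat1 qbin0 big_geq // expr0 !mulr1.
pose T j := (\prod_(0 <= k < j) p ^+ k) * x ^+ j.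
rewrite big_nat_recr //= IH [RHS]big_nat_recl // qbin0.
under [X in _ = _ + X]eq_big_nat => j /andP[_ jM] do rewrite qbinS // mulrDl.
rewrite big_split /= addrA mulrDr mulr1; congr (_ + _).
  have -> : 1 * (\prod_(0 <= k < 0) p ^+ k * x ^+ 0) = qbin M 0 * T 0%N by rewrite qbin0.
  rewrite -(big_nat_recl _ _ (fun j => qbin M j * T j)) // [RHS]big_nat_recr //=.
  by rewrite {3}/qbin ltnn mul0r addr0.
rewrite mulr_suml; apply: eq_big_nat => j /andP[_ jM].
rewrite big_nat_recr //= exprSr.
have -> : p ^+ M = p ^+ (M - j) * p ^+ j by rewrite -exprD subnK.
ring.
Qed.

End QBinomial.

(** * The bracket as a series of Gaussians *)

Section ThetaSeries.
Variables (R : realType) (L : R[i]) (r : R).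
Hypotheses (r0 : 0 < r) (L0 : complex.Re L < 0).
Implicit Types (u x y : R[i]).

Local Notation e := (qpow L).
Let p := e (2 * r%:C).

Lemma qpowD x y : e (x + y) = e x * e y.
Proof. by rewrite /qpow mulrDl cexpD. Qed.

Lemma qpow0 : e 0 = 1. Proof. by rewrite /qpow mul0r cexp0. Qed.

Lemma qpow_neq0 x : e x != 0. Proof. exact: cexp_neq0. Qed.

Lemma qpowX x n : e x ^+ n = e (x * n%:R).
Proof.
elim: n => [|n IH]; first by rewrite mulr0 qpow0.
by rewrite exprS IH -qpowD mulrSr; congr qpow; ring.
Qed.

Lemma qpowV x : (e x)^-1 = e (- x).
Proof. by rewrite /qpow mulNr cexpN. Qed.

Lemma p_lt1 : cnorm p < 1.
Proof.
rewrite cnorm_cexp -[ltRHS]expR0 ltr_expR.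
have -> : 2 * r%:C * L = L * (2 * r)%:C by rewrite rmorphM /= rmorph_nat; ring.
by rewrite Re_mulC nmulr_rlt0 // mulr_gt0.
Qed.

Lemma rC_neq0 : r%:C != 0 :> R[i].
Proof. by rewrite -cnorm_gt0 /cnorm /= expr0n addr0 sqrtr_sqr normr_gt0 gt_eqF. Qed.

(** The n-th term of the theta series times the prefactor of the bracket: with
    p = q^(2r) and z = q^(2u), the exponents in
    q^(u^2/r - u) p^(n(n-1)/2) z^n add up to a function of u + r n alone. *)
Definition gauss u (n : int) : R[i] :=
  e ((u + r%:C * n%:~R) ^+ 2 / r%:C - (u + r%:C * n%:~R)).

Lemma prod_ppow j : \prod_(0 <= k < j) p ^+ k = e (r%:C * (j%:R ^+ 2 - j%:R)).
Proof.
elim: j => [|j IH]; first by rewrite big_geq // expr0n subrr mulr0 qpow0.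
by rewrite big_nat_recr //= IH qpowX -qpowD -[j.+1]addn1 natrD; congr qpow; ring.
Qed.

Lemma prod_shift u m :
  \prod_(0 <= k < m) (- (e (2 * u) / p ^+ k.+1))
  = (-1) ^+ m * e (2 * u * m%:R - r%:C * (m%:R ^+ 2 + m%:R)).
Proof.
elim: m => [|m IH].
  by rewrite big_geq // expr0 expr0n mulr0 addr0 mulr0 subrr qpow0 mul1r.
have step : - (e (2 * u) / p ^+ m.+1) = -1 * e (2 * u - 2 * r%:C * m.+1%:R).
  by rewrite mulN1r qpowX qpowV -qpowD.
rewrite big_nat_recr //= IH step mulrACA -exprSr -qpowD; congr (_ * qpow L _).
by rewrite -[m.+1]addn1 natrD; ring.
Qed.

Lemma ppow_neq1 k : p ^+ k.+1 != 1.
Proof.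
apply/eqP => /(congr1 (@cnorm R)); rewrite cnormX cnorm1 => /eqP.
by rewrite lt_eqF // exprn_ilt1 ?cnorm_ge0 ?p_lt1.
Qed.

Lemma qfact_p_neq0 k : qfact p k != 0.
Proof.
elim: k => [|k IH]; first by rewrite /qfact big_geq // oner_neq0.
by rewrite qfactS mulf_neq0 // subr_eq0 eq_sym ppow_neq1.
Qed.

(** Finite form of the triple product: the q-binomial theorem with 2m factors at
    x = - z p^(-m), whose first m factors are those of (p/z; p) up to monomials. *)
Lemma triple_finite u m :
  pprod p (e (2 * u)) m * pprod p (p / e (2 * u)) m * e (u ^+ 2 / r%:C - u)
  = \sum_(0 <= j < (m + m).+1)
      qbin p (m + m) j * ((-1) ^ (j%:Z - m%:Z) * gauss u (j%:Z - m%:Z)).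
Proof.
set z := e (2 * u); have z0 : z != 0 by apply: qpow_neq0.
have p0 : p != 0 by apply: qpow_neq0.
have pk0 (k : nat) : p ^+ k != 0 by rewrite expf_neq0.
pose x := - z / p ^+ m.
have lower : \prod_(0 <= k < m) (1 + x * p ^+ k)
    = \prod_(0 <= k < m) (- (z / p ^+ k.+1)) * pprod p (p / z) m.
  rewrite big_nat_rev /pprod -big_split /=; apply: eq_big_nat => k /andP[_ km].
  have pm : p ^+ m = p ^+ (m - k.+1) * p ^+ k.+1 by rewrite -exprD subnK.
  by rewrite /x add0n pm exprS; field; rewrite ?z0 ?pk0 ?p0.
have upper : \prod_(m <= k < m + m) (1 + x * p ^+ k) = pprod p z m.
  rewrite -{1}[m]add0n big_addn addnK; apply: eq_big_nat => k _.
  by rewrite /x exprD; field; rewrite pk0.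
have xE : x = -1 * e (2 * u - 2 * r%:C * m%:R).
  by rewrite mulN1r /x qpowX qpowD -qpowV mulNr.
have binom := qbinomial qfact_p_neq0 x (m + m).
rewrite (@big_cat_nat _ _ _ m) ?leq_addr //= lower upper prod_shift in binom.
have C0 : (-1) ^+ m * e (2 * u * m%:R - r%:C * (m%:R ^+ 2 + m%:R)) != 0.
  by rewrite mulf_neq0 ?signr_eq0 ?qpow_neq0.
apply: (mulfI C0).
transitivity ((-1) ^+ m * e (2 * u * m%:R - r%:C * (m%:R ^+ 2 + m%:R))
   * pprod p (p / z) m * pprod p z m * e (u ^+ 2 / r%:C - u)); first by ring.
rewrite binom mulr_suml mulr_sumr; apply: eq_big_nat => j _.
rewrite prod_ppow xE exprMn qpowX.
have sgn : (-1) ^+ j = (-1) ^+ m * (-1) ^ (j%:Z - m%:Z) :> R[i].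
  by rewrite (exprnP _ j) (exprnP _ m) -expfzDr ?oppr_eq0 ?oner_neq0 //; congr (_ ^ _); ring.
transitivity (qbin p (m + m) j * (-1) ^+ j *
   (e (r%:C * (j%:R ^+ 2 - j%:R)) * e ((2 * u - 2 * r%:C * m%:R) * j%:R) * e (u ^+ 2 / r%:C - u))).
  by ring.
transitivity (qbin p (m + m) j * (-1) ^+ j *
  (e (2 * u * m%:R - r%:C * (m%:R ^+ 2 + m%:R)) * gauss u (j%:Z - m%:Z))); last first.
  by rewrite sgn; ring.
congr (_ * _); rewrite /gauss -!qpowD rmorphB /=; congr qpow.
by rewrite -!pmulrn; field; apply: rC_neq0.
Qed.

Lemma gauss_summable u : bounded_sums (fun n => cnorm (gauss u n)).
Proof.
have w2 : complex.Re (L * r%:C) < 0 by rewrite Re_mulC nmulr_rlt0.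
have [B hB] := gauss_bounded ((u ^+ 2 / r%:C - u) * L) ((2 * u - r%:C) * L) w2.
exists B => s us; apply: le_trans (hB s us); apply: ler_sum => n _.
rewrite /gauss /qpow; set x := (X in cexp X); set y := (X in _ <= cnorm (cexp X)).
suff -> : x = y by [].
by rewrite /x /y; field; apply: rC_neq0.
Qed.

Lemma tends_near (z w : nat -> R[i]) l M :
  (forall m, (M <= m)%N -> z m = w m) -> tends w l -> tends z l.
Proof.
move=> zw wl d /wl[M' h]; exists (maxn M M') => m; rewrite geq_max => /andP[m1 m2].
by rewrite zw ?h.
Qed.

Lemma qpoch_p_neq0 : qpoch p p != 0.
Proof. by apply: (qpoch_neq0 p_lt1) => k; rewrite -exprS ppow_neq1. Qed.

(** The Jacobi triple product, as the limit of [triple_finite] multiplied by the m-th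
    partial product of (p; p).  The q-binomial coefficients so normalized tend to 1
    and are bounded, so that Tannery's theorem applies with a Gaussian majorant. *)
Lemma theta_series u : hsum (fun n : int => (-1) ^ n * gauss u n) (ebr L r u).
Proof.
pose c m (n : int) : R[i] := if (`|n| <= m)%N then
  qfact p m * qfact p (m + m) / (qfact p (absz (m%:Z + n)) * qfact p (absz (m%:Z - n))) else 0.
pose supp m := [seq j%:Z - m%:Z | j <- iota 0 (m + m).+1].
have qp m : qfact p m = pprod p p m by [].
have [C hC] := pprod_bound p_lt1 p.
have [d d0 hd] := pprod_lower p_lt1 (fun k => ltac:(by rewrite -exprS; apply: ppow_neq1) : p * p ^+ k != 1).
have C0 : 0 <= C by apply: le_trans (hC 0%N); apply: cnorm_ge0.
have sgn1 (n : int) : cnorm ((-1 : R[i]) ^ n) = 1.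
  by case: n => n; rewrite /exprz /= ?cnormV cnormX cnormN cnorm1 expr1n ?invr1.
apply: (@hsum_dominated _ _ (fun m n => c m n * ((-1) ^ n * gauss u n)) supp _
   (fun n => C * C / (d * d) * cnorm (gauss u n))).
- move=> m n; rewrite !cnormM sgn1 mul1r ler_wpM2r ?cnorm_ge0 //.
  have CC : 0 <= C * C / (d * d) by rewrite divr_ge0 ?mulr_ge0 // ltW.
  rewrite /c; case: ifP => _; last by rewrite cnorm0.
  rewrite cnormM cnormV !cnormM !qp; apply: ler_pM.
  + by rewrite mulr_ge0 ?cnorm_ge0.
  + by rewrite invr_ge0 mulr_ge0 ?cnorm_ge0.
  + by apply: ler_pM; rewrite ?cnorm_ge0.
  + have q0 k : 0 < cnorm (pprod p p k) := lt_le_trans d0 (hd k).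
    rewrite lef_pV2 ?posrE; [|exact: mulr_gt0|exact: mulr_gt0].
    by apply: ler_pM; rewrite ?hd // ltW.
- have [B hB] := gauss_summable u; exists (C * C / (d * d) * B) => s us.
  rewrite -mulr_sumr ler_wpM2l ?hB // divr_ge0 ?mulr_ge0 // ltW //.
- by move=> m; rewrite map_inj_uniq ?iota_uniq // => j k; lia.
- move=> m n nm; rewrite /c; case: ifP => nn; last by rewrite mul0r.
  case/negP: nm; apply/mapP; exists (absz ((n : int) + m%:Z)%R); last by lia.
  by rewrite mem_iota; lia.
- move=> n; rewrite -[X in tends _ X]mul1r; apply: tendsM; last exact: tends_cst.
  have Q := pprod_tends p_lt1 p; have Q0 := qpoch_p_neq0.
  apply: (@tends_near _ (fun m => pprod p p m * pprod p p (m + m)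
     * ((pprod p p (absz (m%:Z + n)))^-1 * (pprod p p (absz (m%:Z - n)))^-1)) _ `|n|).
    by move=> m nm; rewrite /c nm invfM.
  have -> : 1 = qpoch p p * qpoch p p * ((qpoch p p)^-1 * (qpoch p p)^-1).
    by rewrite mulrACA divff // mulr1.
  apply: tendsM; apply: tendsM => //.
  + by apply: (tends_comp (z := pprod p p) (h := fun m => m + m)%N) Q => M; exists M => m; lia.
  + apply: tendsV => //.
    apply: (tends_comp (z := pprod p p) (h := fun m => absz (m%:Z + n)%R)) Q => M.
    by exists (M + `|n|)%N => m; lia.
  + apply: tendsV => //.
    apply: (tends_comp (z := pprod p p) (h := fun m => absz (m%:Z - n)%R)) Q => M.
    by exists (M + `|n|)%N => m; lia.
have sumE m : \sum_(n <- supp m) c m n * ((-1) ^ n * gauss u n)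
    = pprod p p m * (pprod p (e (2 * u)) m * pprod p (p / e (2 * u)) m * e (u ^+ 2 / r%:C - u)).
  rewrite triple_finite mulr_sumr big_map /index_iota subn0.
  apply: eq_big_seq => j; rewrite mem_iota => /andP[_ jm]; rewrite [RHS]mulrA; congr (_ * _).
  have -> : c m (j%:Z - m%:Z) = qfact p m * qbin p (m + m) j; last by [].
  rewrite /c /qbin; have -> : (absz (j%:Z - m%:Z)%R <= m)%N by lia.
  have -> : (j <= m + m)%N by lia.
  have -> : absz (m%:Z + (j%:Z - m%:Z))%R = j by lia.
  have -> : absz (m%:Z - (j%:Z - m%:Z))%R = (m + m - j)%N by lia.
  by rewrite mulrA.
apply: (tends_near (M := 0) (fun m _ => sumE m)).
have -> : ebr L r u = qpoch p p * (qpoch (e (2 * u)) p * qpoch (p / e (2 * u)) p * e (u ^+ 2 / r%:C - u)).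
  by rewrite /ebr /Theta -/p; ring.
apply: tendsM; first exact: (pprod_tends p_lt1).
apply: tendsM; last exact: tends_cst.
by apply: tendsM; exact: (pprod_tends p_lt1).
Qed.

(** The product of the series of [x + y] and [x - y] is a sum over Z^2 of Gaussians in
    X = x + y + r (m - 1/2) and Y = x - y + r (n - 1/2), and X^2 + Y^2 is half of
    (X + Y)^2 + (X - Y)^2.  Here X + Y = 2x + r j and X - Y = 2y + r k with
    j = m + n - 1 and k = m - n, of opposite parities.  The pairs with j odd and k even
    contribute A(x) B(y), the others, with the opposite sign, - B(x) A(y). *)
Lemma ebr_rank_two : rank_two (ebr L r).
Proof.
have w2 : complex.Re (L * (2 * r)%:C) < 0 by rewrite Re_mulC nmulr_rlt0 // mulr_gt0.
have rC := rC_neq0; have two0 : (2 : R[i]) != 0 by rewrite pnatr_eq0.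
have r2C : (2 * r)%:C = 2 * r%:C by rewrite rmorphM /= rmorph_nat.
pose even x (b : int) := e ((2 * x + 2 * r%:C * b%:~R) ^+ 2 / (2 * r%:C)).
pose odd x (a : int) := e ((2 * x + r%:C * (2 * a%:~R + 1)) ^+ 2 / (2 * r%:C)).
have even_ex x : exists S, hsum (even x) S.
  apply: hsum_exists.
  have [B hB] := gauss_bounded ((2 * x) ^+ 2 / (2 * r%:C) * L) (4 * x * L) w2.
  exists B => s us; apply: le_trans (hB s us); apply: ler_sum => n _.
  rewrite /even /qpow; set X := (X in cexp X); set Y := (X in _ <= cnorm (cexp X)).
  suff -> : X = Y by [].
  by rewrite /X /Y r2C; field.
have odd_ex x : exists S, hsum (odd x) S.
  apply: hsum_exists.
  have [B hB] := gauss_bounded ((2 * x + r%:C) ^+ 2 / (2 * r%:C) * L)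
    ((4 * x + 2 * r%:C) * L) w2.
  exists B => s us; apply: le_trans (hB s us); apply: ler_sum => n _.
  rewrite /odd /qpow; set X := (X in cexp X); set Y := (X in _ <= cnorm (cexp X)).
  suff -> : X = Y by [].
  by rewrite /X /Y r2C; field.
pose c := e (- (r%:C / 2)).
exists (fun x => c * projT1 (cid (odd_ex x))), (fun y => projT1 (cid (even_ex y))) => x y.
case: (cid (odd_ex x)) => /= Ox hOx; case: (cid (odd_ex y)) => /= Oy hOy.
case: (cid (even_ex x)) => /= Ex hEx; case: (cid (even_ex y)) => /= Ey hEy.
have prod := hsum_prod (theta_series (x + y)) (theta_series (x - y)).
(* The first summand enumerates the pairs (m, n) with m - n even. *)
pose h (z : (int * int) + (int * int)) : int * int := match z with
  | inl (a, b) => (a + b + 1, a - b + 1)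
  | inr (a, b) => (a + b + 1, a - b) end.
pose g (z : int * int) : (int * int) + (int * int) :=
  let b := ((z.1 - z.2) %/ 2)%Z in
  if (2 %| z.1 - z.2)%Z then inl (z.1 - b - 1, b) else inr (z.2 + b, b).
have hK : cancel h g.
  case=> [[a b]|[a b]]; rewrite /g /h /=.
    have -> : a + b + 1 - (a - b + 1) = b * 2 by ring.
    by rewrite dvdz_mull // mulzK //; congr (inl (_, _)); ring.
  have -> : a + b + 1 - (a - b) = b * 2 + 1 by ring.
  have -> : (2 %| b * 2 + 1)%Z = false by lia.
  have -> : ((b * 2 + 1) %/ 2)%Z = b by lia.
  by congr (inr (_, _)); ring.
have gK : cancel g h.
  case=> m n; rewrite /g /=; case: ifP => mn; rewrite /h; congr (_, _); lia.
have prod' := hsum_reindex hK gK prod.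
have sgn2 (k : int) : (-1) ^ (k + k) = 1 :> R[i].
  by rewrite expfzDr ?oppr_eq0 ?oner_neq0 // -expfzMl mulrNN mul1r exp1rz.
have sgnM (k l : int) : (-1) ^ k * (-1) ^ l = (-1) ^ (k + l) :> R[i].
  by rewrite expfzDr ?oppr_eq0 ?oner_neq0.
apply: (hsum_uniq prod').
have -> : c * Ox * Ey - Ex * (c * Oy) = c * (Ox * Ey) + - c * (Ex * Oy) by ring.
apply: hsum_sumtype.
- apply: eq_hsum (hsumZ c (hsum_prod hOx hEy)) => -[a b] /=.
  rewrite mulrACA sgnM (_ : a + b + 1 + (a - b + 1) = (a + 1) + (a + 1)); last by ring.
  rewrite sgn2 mul1r /c /odd /even /gauss -!qpowD; congr qpow.
  by rewrite !rmorphD rmorphN /= rmorph1; field.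
- apply: eq_hsum (hsumZ (- c) (hsum_prod hEx hOy)) => -[a b] /=.
  rewrite mulrACA sgnM (_ : a + b + 1 + (a - b) = (a + a) + 1); last by ring.
  rewrite -sgnM sgn2 mul1r expr1z mulN1r mulNr /c /odd /even /gauss -!qpowD.
  by congr (- qpow L _); rewrite !rmorphD rmorphN /= rmorph1; field.
Qed.

(** An infinite product vanishes only if one of its factors does. *)
Lemma Theta_eq0 u : Theta p (e (2 * u)) = 0 <-> exists n : int, e (2 * u) = p ^ n.
Proof.
have p0 : p != 0 by apply: qpow_neq0.
have z0 : e (2 * u) != 0 by apply: qpow_neq0.
split=> [|[[n|n] zn]].
- move=> /eqP; rewrite /Theta !mulf_eq0 (negbTE qpoch_p_neq0) orbF => /orP[] h.
    have [k zk] : exists k, e (2 * u) * p ^+ k = 1.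
      apply: contrapT => nk; move: h; apply/negP; apply: (qpoch_neq0 p_lt1) => k.
      by apply/eqP => zk; apply: nk; exists k.
    exists (- k%:Z); rewrite -exprz_inv -exprnP exprVn.
    by apply: (mulIf (expf_neq0 k p0)); rewrite zk mulVf // expf_neq0.
  have [k zk] : exists k, p / e (2 * u) * p ^+ k = 1.
    apply: contrapT => nk; move: h; apply/negP; apply: (qpoch_neq0 p_lt1) => k.
      by apply/eqP => zk; apply: nk; exists k.
  exists k.+1%:Z; rewrite -exprnP exprS; apply: (mulfI (invr_neq0 z0)).
  by rewrite mulVf // mulrA [_ * p]mulrC zk.
- case: n zn => [|n] zn.
    by rewrite /Theta (qpoch_eq0 p_lt1 (k := 0)) ?mul0r // zn expr0z mulr1.
  rewrite /Theta [X in _ * X * _](qpoch_eq0 p_lt1 (k := n)) ?mulr0 ?mul0r //.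
  by rewrite zn -exprnP exprS; field; rewrite p0 expf_neq0.
- rewrite /Theta (qpoch_eq0 p_lt1 (k := n.+1)) ?mul0r //.
  by rewrite zn NegzE -exprz_inv -exprnP exprVn mulVf // expf_neq0.
Qed.

Lemma ebr_eq0 u : ebr L r u = 0 <-> exists n : int, e (2 * u) = p ^ n.
Proof.
rewrite -Theta_eq0 /ebr -/p; split=> [/eqP|->]; last by rewrite mulr0.
by rewrite mulf_eq0 (negbTE (qpow_neq0 _)) => /eqP.
Qed.

Lemma ebr_zeroD x y : ebr L r x = 0 -> ebr L r y = 0 -> ebr L r (x + y) = 0.
Proof.
move=> /ebr_eq0[m xm] /ebr_eq0[n yn]; apply/ebr_eq0; exists (m + n).
by rewrite mulrDr qpowD xm yn expfzDr // qpow_neq0.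
Qed.

End ThetaSeries.

(** * The theorem *)

Lemma counted_word (N n : nat) (lam : 'I_N -> nat) (mu : n.-tuple 'I_N) :
  calI lam (Iword mu) -> forall l, lamU lam l = #|Iup mu l|.
Proof.
case=> card_mu _ _ l; rewrite -sum1_card.
rewrite (partition_big (fun k => tnth mu k) (fun j : 'I_N => (j < l)%N)) /=; last first.
  by move=> k /bigcupP[j jl]; rewrite inE => /eqP ->.
apply: eq_bigr => j jl; rewrite -card_mu -sum1_card; apply: eq_bigl => k.
rewrite inE andbC; case: eqP => //= kj.
by symmetry; apply/bigcupP; exists j => //; rewrite inE kj.
Qed.

Theorem proposition5p2 (R : realType) (q logq : R[i]) (r : R)
  (hlogq : cexp logq = q) (hq : 0 < `|q| < 1) (hr : 0 < r)
  (N n : nat) (lam : 'I_N -> nat) (hlam : (\sum_(l < N) lam l)%N = n)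
  (mu : n.-tuple 'I_N) (hmu : calI lam (Iword mu))
  (i i1 : 'I_n) (hi : (i1 : nat) = i.+1)
  (v : vars R[i] lam) (u : n.-tuple R[i]) (P : 'I_N -> 'I_N -> R[i])
  (hP : forall j k l, P j k + P k l = P j l)
  (* genericity: the denominators occurring in the identity do not vanish *)
  (genP : forall j k, j != k -> forall m : int, ebr logq r (P j k + m%:~R) != 0)
  (genv : forall l : 'I_N, (0 < l)%N -> forall a b : 'I_(lamU lam l), a != b ->
     ebr logq r (v l b - v l a) != 0)
  (genH : weightH (ebr logq r) v u != 0)
  (genR : ebr logq r (tnth u i - tnth u i1 + 1) != 0) :
  weightWt (ebr logq r) (upd2 i i1 (tnth mu i1) (tnth mu i) mu) v
    (upd2 i i1 (tnth u i1) (tnth u i) u) P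
  = \sum_(m : 'I_N) \sum_(m1 : 'I_N)
      Rbar (ebr logq r) (tnth u i - tnth u i1)
        (shiftP mu (fun j => if (i <= j)%N then -1 else 0) P)
        (tnth mu i) (tnth mu i1) m m1
      * weightWt (ebr logq r) (upd2 i i1 m m1 mu) v u P.
Proof.
have L0 : complex.Re logq < 0.
  case/andP: hq => _; rewrite -hlogq cnormE cnorm_cexp -[1]/(1%:C) ltcR.
  by rewrite -[ltRHS]expR0 ltr_expR.
case: N lam hlam mu hmu v P hP genP genv genH => [|N'] lam hlam mu hmu v P hP genP genv _.
  by case: (tnth mu i).
have lamN : lamU lam N'.+1 = n.
  by rewrite -[RHS]hlam; apply: eq_bigl => j; rewrite ltn_ord.
apply: weightWt_exchange => //.
- exact: ebr_rank_two.
- exact: ebr_zeroD.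
- exact: counted_word.
- by move=> l /andP[l0 lN]; apply: (genv (Ordinal lN)).
Qed.
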